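(* Let $(X,d,\nu)$ be a computable metric space. Then the following conditions are equivalent: (1) There exist a computable map $b:\mathbb{N}\to\Delta^0_1(X)$ and a c.e. refined inclusion of $b$ with respect to $\alpha$ such that $\mathcal{B}:=\operatorname{im}b$ is a basis for the topology of $X$. (2) The operation $N:\subseteq\Pi^0_1(X)^2\rightrightarrows\Delta^0_1(X)$, $\operatorname{dom}N=\{(A,B) : A\cap B=\emptyset\}$, $N(A,B)=\{W : A\subseteq W\wedge B\subseteq X\setminus W\}$, is computable. (3) The operation $\overline{M}:\subseteq X\times\Pi^0_1(X)\rightrightarrows\Delta^0_1(X)$, $\operatorname{dom}\overline{M}=\{(x,A) : x\notin A\}$, $\overline{M}(x,A)=N(\{x\},A)$, is computable. (4) The operation $M:\subseteq X\times\Sigma^0_1(X)\rightrightarrows\Delta^0_1(X)$, $\operatorname{dom}M=\{(x,U) : x\in U\}$, $M(x,U)=\{W\in\Delta^0_1(X) : x\in W\subseteq U\}$, is computable. (5) The operation $\dot{C}^{\omega}:\subseteq\Sigma^0_1(X)^{\mathbb{N}}\rightrightarrows\Sigma^0_1(X)^{\mathbb{N}}\times\mathbb{B}$, $\operatorname{dom}\dot{C}^{\omega}=\{(U_i)_i : \bigcup_iU_i=X\}$, $$\dot{C}^{\omega}((U_i)_i)=\{((W_i)_i,r) : (W_i)_i\text{ pairwise disjoint},\ \textstyle\bigcup_iW_i=X,\ (\forall i)\,W_i\subseteq U_{r_i}\},$$ is computable. (6) The operation $C^{\omega}:\subseteq\Sigma^0_1(X)^{\mathbb{N}}\rightrightarrows\Sigma^0_1(X)^{\mathbb{N}}$,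 $\operatorname{dom}C^{\omega}=\{(U_i)_i : \bigcup_iU_i=X\}$, $$C^{\omega}((U_i)_i)=\{(W_i)_i : (W_i)_i\text{ pairwise disjoint},\ (\forall i)\,W_i\subseteq U_i,\ \textstyle\bigcup_iW_i=\bigcup_iU_i\},$$ is computable. (7) For every computable metric space $(Z,d',\nu')$ the operation $R^X\circ C^{\omega}\circ L'$ is computable, where $L':\mathrm{C}_{\mathrm{s}}(\delta_Z,\delta_{\Sigma^0_1(X)})\to\Sigma^0_1(X)^{\mathbb{N}}$, $u\mapsto(u(\nu'(i)))_{i\in\mathbb{N}}$, and $R^X:\subseteq\Sigma^0_1(X)^{\mathbb{N}}\to\Delta^0_1(X)^{\mathbb{N}}$, $(V_i)_i\mapsto(V_i)_i$ with $\operatorname{dom}R^X=\{(V_i)_i : (V_i)_i\text{ pairwise disjoint},\ \bigcup_iV_i=X\}$. (8) The operation $C^{*}:\subseteq\Sigma^0_1(X)^{*}\rightrightarrows\Sigma^0_1(X)^{*}$, $\operatorname{dom}C^{*}=\{(U_i)_{i<n} : n\in\mathbb{N},\ \bigcup_iU_i=X\}$, $$C^{*}((U_i)_{i<k})=\{(V_j)_{j<k} : (\forall i<k)\,V_i\subseteq U_i,\ \textstyle\bigcup_jV_j=X,\ (\forall i,j<k)(i\neq j\implies V_i\cap V_j=\emptyset)\},$$ is computable.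
   Context: TTE conventions. $\mathbb{B}=\mathbb{N}^{\mathbb{N}}$, $p_i:=p(i)$. $\langle\cdot,\cdot\rangle:\mathbb{N}^2\to\mathbb{N}$ is a standard computable pairing bijection. On $\mathbb{B}$: $\langle p^{(0)},p^{(1)}\rangle(2i+z)=p^{(z)}_i$ ($z\in\{0,1\}$) and $\langle p^{(0)},p^{(1)},\dots\rangle(\langle i,j\rangle)=p^{(i)}_j$. A representation of a set is a partial surjection $\delta:\subseteq\mathbb{B}\to X$; if $\delta(p)=x$, $p$ is a $\delta$-name of $x$. A multi-valued operation $f:\subseteq X\rightrightarrows Y$ assigns to each $x\in\operatorname{dom}f$ a subset $f(x)\subseteq Y$; a realiser of $f$ w.r.t. representations $\delta,\delta'$ of $X,Y$ is $F:\subseteq\mathbb{B}\to\mathbb{B}$ such that whenever $p\in\operatorname{dom}\delta$ and $\delta(p)\in\operatorname{dom}f$, $F(p)$ is defined, $F(p)\in\operatorname{dom}\delta'$ and $\delta'(F(p))\in f(\delta(p))$; $f$ is computable if it has a (Type-2 Turing machine) computable realiser. Composition: $\operatorname{dom}(g\circ f)=\{x\in\operatorname{dom}f : f(x)\subseteq\operatorname{dom}g\}$ and $(g\circ f)(x)=\bigcup_{y\in f(x)}g(y)$. Finite products carry $[\delta_1,\delta_2]\langle p,q\rangle=(\delta_1(p),\delta_2(q))$; countable powers carry $\delta^{\omega}\langle p^{(0)},p^{(1)},\dots\rangle=(\delta(p^{(i)}))_i$; the set $X^*$ of finite words carries $\delta^{*}(n.\langle p^{(0)},p^{(1)},\dots\rangle)=\delta(p^{(0)})\dots\delta(p^{(n-1)})$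 (empty word if $n=0$), where $n.q$ is $q$ prefixed by $n$; $\mathbb{N}$ carries $\delta_{\mathbb{N}}(p)=p_0$; $\mathbb{B}$ carries the identity. Function spaces: $\mathrm{C}_{\mathrm{s}}(\delta,\delta')$ is the set of total maps having a continuous $(\delta,\delta')$-realiser; it carries $[\delta\to\delta']$, where $p$ is a name of $f$ iff $\eta_p$ realises $f$, $\eta$ being a standard representation (satisfying utm and smn theorems) of the continuous partial functions $\subseteq\mathbb{B}\to\mathbb{B}$ with $G_\delta$ domain. Computable metric space $(X,d,\nu)$: $(X,d)$ is a metric space, $\nu:\mathbb{N}\to X$ is total with dense image, and $(i,j)\mapsto d(\nu(i),\nu(j))$ is a computable double sequence of reals. $X$ carries the Cauchy representation $\delta_X$: $p$ is a name of $x$ iff $\lim_i\nu(p_i)=x$ and $d(\nu(p_i),\nu(p_j))<2^{-\min\{i,j\}}$ for all $i,j$ (similarly $\delta_Z$ for $(Z,d',\nu')$). With $\nu_{\mathbb{Q}^+}$ a standard total numbering of the positive rationals, $\alpha\langle a,r\rangle=B_d(\nu(a);\nu_{\mathbb{Q}^+}(r))$ numbers the ideal open balls. $\Sigma^0_1(X)$ (open sets) carries $\delta_{\Sigma^0_1}(p)=\bigcup\{\alpha(p_i-1) : p_i\geq1\}$ (also written $\delta_{\Sigma^0_1(X)}$); $\Pi^0_1(X)$ (closed sets) carries $\delta_{\Pi^0_1}(p)=X\setminus\delta_{\Sigma^0_1}(p)$; $\Delta^0_1(X)$ (clopen sets) carries $\delta_{\Delta^0_1}\langle p,q\rangle=W$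 whenever $W=\delta_{\Sigma^0_1}(p)=\delta_{\Pi^0_1}(q)$. Refined inclusion: for $b:\mathbb{N}\to\Sigma^0_1(X)$ with image a basis, $\sqsubset'\subseteq\mathbb{N}^2$ is a refined inclusion of $b$ with respect to $\alpha$ if (a) $m\sqsubset' n\implies b(m)\subseteq\alpha(n)$, and (b) for all $n\in\mathbb{N}$ and $x\in\alpha(n)$ there is $m$ with $x\in b(m)$ and $m\sqsubset' n$. *)

(* Defs.v *)
From mathcomp Require Import all_boot all_order all_algebra.
From mathcomp Require Import all_classical all_reals all_analysis.
From Stdlib.Arith Require Cantor.

Set Implicit Arguments.
Unset Strict Implicit.
Unset Printing Implicit Defensive.

Import Order.TTheory GRing.Theory Num.Theory.
Local Open Scope classical_set_scope.
Local Open Scope ring_scope.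

Definition baire := nat -> nat.

Definition pairn (i j : nat) : nat := Cantor.to_nat (i, j).
Definition unpairn (n : nat) : nat * nat := Cantor.of_nat n.

(* [p] is the pair <evens p, odds p>, and it is the countable tuple
   <slice p 0, slice p 1, ...>; both tuplings are bijective, so a name is
   described through its components. *)
Definition evens (p : baire) : baire := fun i => p (2 * i)%N.
Definition odds (p : baire) : baire := fun i => p (2 * i + 1)%N.
Definition slice (p : baire) (i : nat) : baire := fun j => p (pairn i j).

(* Programs for the partial recursive functionals: unary partial functions on
   [nat], generated from the basic functions and the oracle by pairing,
   composition, primitive recursion and unbounded search. *)
Inductive code : Type :=
| Zero | Succ | Fst | Snd | Oracle
| Pair of code & code
| Comp of code & code
| Rec of code & code
| Mu of code.

(* [eval p c n m]: program [c] with oracle [p] halts on input [n] with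
   value [m]. *)
Inductive eval (p : baire) : code -> nat -> nat -> Prop :=
| eval_zero n : eval p Zero n 0%N
| eval_succ n : eval p Succ n n.+1
| eval_fst n : eval p Fst n (unpairn n).1
| eval_snd n : eval p Snd n (unpairn n).2
| eval_oracle n : eval p Oracle n (p n)
| eval_pair c d n a b :
    eval p c n a -> eval p d n b -> eval p (Pair c d) n (pairn a b)
| eval_comp c d n a b :
    eval p d n a -> eval p c a b -> eval p (Comp c d) n b
| eval_rec0 c d n a :
    eval p c n a -> eval p (Rec c d) (pairn n 0%N) a
| eval_recS c d n k a b :
    eval p (Rec c d) (pairn n k) a -> eval p d (pairn n (pairn k a)) b ->
    eval p (Rec c d) (pairn n k.+1) b
| eval_mu c n k :
    eval p c (pairn n k) 0%N ->
    (forall j, (j < k)%N -> exists a, eval p c (pairn n j) a.+1) ->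
    eval p (Mu c) n k.

(* Type-2 computability: graph of the partial map on Baire space computed by
   [c].  A Type-2 machine that writes q(0), q(1), ... while reading p yields an
   oracle program for n |-> q(n), and conversely; [p] is in the domain iff [c]
   with oracle [p] halts on every input. *)
Definition computes (c : code) (p q : baire) : Prop :=
  forall n, eval p c n (q n).

Definition eval0 : code -> nat -> nat -> Prop := eval (fun=> 0%N).

Definition ce_rel (S : nat -> nat -> Prop) : Prop :=
  exists c, forall m n, S m n <-> exists k, eval0 c (pairn m n) k.

(* [delta p x] means that [p] is a [delta]-name of [x]. *)
Definition representation (X : Type) := baire -> X -> Prop.

(* A multi-valued operation from [X] to [Y]; [op_val] is only meaningful on
   [op_dom]. *)
Record operation (X Y : Type) := Operation {
  op_dom : set X;
  op_val : X -> set Y }.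

Definition op_fun (X Y : Type) (f : X -> Y) : operation X Y :=
  Operation setT (fun x => [set f x]).

Definition op_comp (X Y Z : Type) (g : operation Y Z) (f : operation X Y) :
    operation X Z :=
  Operation [set x | op_dom f x /\ op_val f x `<=` op_dom g]
            (fun x => \bigcup_(y in op_val f x) op_val g y).

(* A partial map on Baire space is given by its graph [F].  Since [computes c],
   [eta p] and the representations below are single-valued, the witnesses [q]
   and [y] are F(p) and dY(F(p)). *)
Definition realises (X Y : Type) (dX : representation X)
    (dY : representation Y) (F : baire -> baire -> Prop)
    (f : operation X Y) : Prop :=
  forall p x, dX p x -> op_dom f x ->
    exists q, F p q /\ exists y, dY q y /\ op_val f x y.

Definition computable (X Y : Type) (dX : representation X)
    (dY : representation Y) (f : operation X Y) : Prop :=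
  exists c, realises dX dY (computes c) f.

Definition rep_nat : representation nat := fun p n => p 0%N = n.

Definition rep_baire : representation baire := fun p q => p = q.

Definition rep_prod (X Y : Type) (dX : representation X)
    (dY : representation Y) : representation (X * Y) :=
  fun p z => dX (evens p) z.1 /\ dY (odds p) z.2.

Definition rep_omega (X : Type) (dX : representation X) :
    representation (nat -> X) :=
  fun p x => forall i, dX (slice p i) (x i).

Definition rep_star (X : Type) (dX : representation X) :
    representation (seq X) :=
  fun p w => size w = p 0%N /\
    forall i x, onth w i = Some x -> dX (slice (fun j => p j.+1) i) x.

Fixpoint code_word (w : seq nat) : nat :=
  if w is a :: w' then (pairn a (code_word w')).+1 else 0%N.

(* The standard representation of the continuous partial maps on Baire space
   with G_delta domain, in Kleene's form: [eta p] is the graph of the map sending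
   [q] to [r] iff, for each [n], the first prefix [w] of [q] such that
   [p <n, w>] is nonzero satisfies [p <n, w> = r n + 1]. *)
Definition eta (p q r : baire) : Prop :=
  forall n, exists k,
    p (pairn n (code_word (mkseq q k))) = (r n).+1 /\
    forall j, (j < k)%N -> p (pairn n (code_word (mkseq q j))) = 0%N.

Definition has_continuous_realiser (X Y : Type) (dX : representation X)
    (dY : representation Y) (f : X -> Y) : Prop :=
  exists (D : set {ptws nat -> nat})
         (F : {ptws nat -> nat} -> {ptws nat -> nat}),
    {within D, continuous F} /\
    realises dX dY (fun p q => D p /\ F p = q) (op_fun f).

Record Cs (X Y : Type) (dX : representation X) (dY : representation Y) := MkCs {
  Cs_fun :> X -> Y;
  CsP : has_continuous_realiser dX dY Cs_fun }.

Definition rep_Cs (X Y : Type) (dX : representation X)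
    (dY : representation Y) : representation (Cs dX dY) :=
  fun p f => realises dX dY (eta p) (op_fun f).

Section Numberings.
Variable R : realType.

Definition nuQ (n : nat) : R :=
  let: (m, c) := unpairn n in
  let: (a, b) := unpairn m in (a%:R - b%:R) / c.+1%:R.

Definition nuQpos (n : nat) : R :=
  let: (a, b) := unpairn n in a.+1%:R / b.+1%:R.

Definition computable_double_seq (x : nat -> nat -> R) : Prop :=
  exists c, forall i j k, exists m,
    eval0 c (pairn i (pairn j k)) m /\ `|x i j - nuQ m| < 2 ^- k.

End Numberings.

Record computableMetricSpace (R : realType) := ComputableMetricSpace {
  cms_space :> metricType R;
  nu : nat -> cms_space;
  nu_dense : dense (range nu);
  nu_computable : computable_double_seq (fun i j => mdist (nu i) (nu j)) }.

Record Sigma01 (X : topologicalType) := MkSigma01 {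
  Sigma01_set :> set X;
  Sigma01P : open Sigma01_set }.

Record Pi01 (X : topologicalType) := MkPi01 {
  Pi01_set :> set X;
  Pi01P : closed Pi01_set }.

Record Delta01 (X : topologicalType) := MkDelta01 {
  Delta01_set :> set X;
  Delta01P : clopen Delta01_set }.

Section Hyperspaces.
Variables (R : realType) (X : computableMetricSpace R).

Definition rep_cauchy : representation X := fun p x =>
  (fun i => nu X (p i)) @ \oo --> x /\
  forall i j, mdist (nu X (p i)) (nu X (p j)) < 2 ^- minn i j.

Definition alpha (n : nat) : set X :=
  let: (a, r) := unpairn n in ball (nu X a) (nuQpos R r).

Definition named_open (p : baire) : set X :=
  \bigcup_(i in [set i | (1 <= p i)%N]) alpha (p i - 1).

Definition rep_Sigma01 : representation (Sigma01 X) :=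
  fun p U => U = named_open p :> set X.

Definition rep_Pi01 : representation (Pi01 X) :=
  fun p A => A = ~` named_open p :> set X.

Definition rep_Delta01 : representation (Delta01 X) := fun p W =>
  W = named_open (evens p) :> set X /\ W = ~` named_open (odds p) :> set X.

Definition refined_inclusion (b : nat -> set X) (S : nat -> nat -> Prop) : Prop :=
  (forall m n, S m n -> b m `<=` alpha n) /\
  (forall n x, alpha n x -> exists m, b m x /\ S m n).

Definition op_N : operation (Pi01 X * Pi01 X) (Delta01 X) :=
  Operation [set AB : Pi01 X * Pi01 X | (AB.1 : set X) `&` AB.2 = set0]
            (fun AB => [set W : Delta01 X | AB.1 `<=` W /\ AB.2 `<=` ~` W]).

Definition Pi01_point (x : X) : Pi01 X :=
  MkPi01 (accessible_closed_set1
    (hausdorff_accessible (metric_hausdorff (T := X))) (x := x)).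

Definition op_Mbar : operation (X * Pi01 X) (Delta01 X) :=
  Operation [set xA : X * Pi01 X | ~ (xA.2 : set X) xA.1]
            (fun xA => op_val op_N (Pi01_point xA.1, xA.2)).

Definition op_M : operation (X * Sigma01 X) (Delta01 X) :=
  Operation [set xU : X * Sigma01 X | (xU.2 : set X) xU.1]
            (fun xU => [set W : Delta01 X |
                         (W : set X) xU.1 /\ W `<=` xU.2]).

Definition pairwise_disjoint (W : nat -> Sigma01 X) : Prop :=
  trivIset setT (fun i => W i : set X).

Definition covers (U : nat -> Sigma01 X) : Prop :=
  \bigcup_i (U i : set X) = setT.

Definition op_Cdot :
    operation (nat -> Sigma01 X) ((nat -> Sigma01 X) * baire) :=
  Operation [set U | covers U]
            (fun U => [set Wr : (nat -> Sigma01 X) * baire |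
               [/\ pairwise_disjoint Wr.1, covers Wr.1 &
                   forall i, Wr.1 i `<=` U (Wr.2 i)]]).

Definition op_C : operation (nat -> Sigma01 X) (nat -> Sigma01 X) :=
  Operation [set U | covers U]
            (fun U => [set W : nat -> Sigma01 X |
               [/\ pairwise_disjoint W, forall i, W i `<=` U i &
                   \bigcup_i (W i : set X) = \bigcup_i (U i : set X)]]).

Definition op_R : operation (nat -> Sigma01 X) (nat -> Delta01 X) :=
  Operation [set V | pairwise_disjoint V /\ covers V]
            (fun V => [set W : nat -> Delta01 X |
                        forall i, W i = V i :> set X]).

(* The [i]-th letter of a word of open sets, and the empty set from position
   [size U] on. *)
Definition letter (U : seq (Sigma01 X)) (i : nat) : set X :=
  nth set0 (map (@Sigma01_set X) U) i.

Definition op_Cstar : operation (seq (Sigma01 X)) (seq (Sigma01 X)) :=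
  Operation [set U | \bigcup_(i < size U) letter U i = setT]
            (fun U => [set V : seq (Sigma01 X) | [/\ size V = size U,
               forall i, (i < size U)%N -> letter V i `<=` letter U i,
               \bigcup_(j < size U) letter V j = setT &
               forall i j, (i < size U)%N -> (j < size U)%N -> i <> j ->
                 letter V i `&` letter V j = set0]]).

End Hyperspaces.

Arguments rep_cauchy {R} X.
Arguments rep_Sigma01 {R} X.
Arguments rep_Pi01 {R} X.
Arguments rep_Delta01 {R} X.
Arguments op_N {R} X.
Arguments op_Mbar {R} X.
Arguments op_M {R} X.
Arguments op_Cdot {R} X.
Arguments op_C {R} X.
Arguments op_R {R} X.
Arguments op_Cstar {R} X.

Definition op_L (R : realType) (X Z : computableMetricSpace R) :
    operation (Cs (rep_cauchy Z) (rep_Sigma01 X)) (nat -> Sigma01 X) :=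
  op_fun (fun (u : Cs _ _) i => u (nu Z i)).

(* Main.v *)
From HB Require Import structures.
From Pilot Require Import Defs.
From mathcomp Require Import all_boot all_order all_algebra.
From mathcomp Require Import all_classical all_reals all_analysis.
From mathcomp Require Import ring lra.
Import Pilot.Defs.

Set Implicit Arguments.
Unset Strict Implicit.
Unset Printing Implicit Defensive.

Local Open Scope classical_set_scope.

(** From a clopen basis [b] with a c.e. refined inclusion, every name of an open
    cover yields an enumeration of basic clopen sets, each inside a known member
    of the cover; subtracting from each the finitely many earlier ones makes them
    disjoint, and the differences are uniformly open because the complements
    have names as well and formal inclusion of ideal balls is semi-decidable.
    This gives (5); grouping the pieces gives (6), a disjoint open cover is
    uniformly clopen, which gives (7), and maps on the discrete space of natural
    numbers are sequences of open sets, which gives (8).  A two-letter word in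
    (8) separates two closed sets, hence (2), (3) and (4).

    For (4) => (1), run the program for [M] on all names that are eventually
    constant, together with an ideal ball containing the point they name.  By
    the finite use of the oracle, the fact that [M] puts [x] into its answer is
    decided by a finite prefix of a name of [x], so it also holds for the
    eventually constant extension of that prefix: the answers obtained from
    eventually constant names already form a basis. *)

(** * Programs and recursive functionals *)

Lemma pairnK i j : unpairn (pairn i j) = (i, j).
Proof. exact: Cantor.cancel_of_to. Qed.

Lemma unpairnK n : pairn (unpairn n).1 (unpairn n).2 = n.
Proof. by rewrite /pairn -surjective_pairing; exact: Cantor.cancel_to_of. Qed.

Lemma unpairn0 : unpairn 0 = (0, 0)%N.
Proof. by []. Qed.

#[local] Opaque pairn unpairn.

(* The induction principle generated by Rocq has no hypothesis for the
   evaluations hidden under the existential of [eval_mu]. *)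
Lemma eval_nested_ind (p : baire) (P : code -> nat -> nat -> Prop) :
  (forall n, P Zero n 0%N) -> (forall n, P Succ n n.+1) ->
  (forall n, P Fst n (unpairn n).1) -> (forall n, P Snd n (unpairn n).2) ->
  (forall n, P Oracle n (p n)) ->
  (forall c d n a b, P c n a -> P d n b -> P (Pair c d) n (pairn a b)) ->
  (forall c d n a b, P d n a -> P c a b -> P (Comp c d) n b) ->
  (forall c d n a, P c n a -> P (Rec c d) (pairn n 0%N) a) ->
  (forall c d n k a b, P (Rec c d) (pairn n k) a ->
     P d (pairn n (pairn k a)) b -> P (Rec c d) (pairn n k.+1) b) ->
  (forall c n k, P c (pairn n k) 0%N ->
     (forall j, (j < k)%N -> exists a, P c (pairn n j) a.+1) -> P (Mu c) n k) ->
  forall c n m, eval p c n m -> P c n m.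
Proof.
move=> h0 h1 h2 h3 h4 h5 h6 h7 h8 h9; fix IH 4 => c n m [] {c n m}.
- exact: h0.
- exact: h1.
- exact: h2.
- exact: h3.
- exact: h4.
- by move=> c d n a b /IH ? /IH ?; apply: h5.
- by move=> c d n a b /IH ca /IH; apply: h6.
- by move=> c d n a /IH; apply: h7.
- by move=> c d n k a b /IH ca /IH; apply: h8.
- move=> c n k /IH ck lt_k; apply: h9 => // j /lt_k [a ja].
  by exists a; apply: IH.
Qed.

(** A halting evaluation is a finite derivation, so it consults the oracle only below some bound
    [K]. This continuity lets a name be replaced by an eventually constant one. *)
Lemma eval_finite_use p c n m : eval p c n m ->
  exists K, forall p', (forall i, (i < K)%N -> p i = p' i) -> eval p' c n m.
Proof.
elim/eval_nested_ind => {c n m}.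
1-4: by move=> n; exists 0%N => p' _; constructor.
- by move=> n; exists n.+1 => p' ->//; constructor.
- move=> c d n a b [K hK] [L hL]; exists (maxn K L) => p' hp.
  by constructor; [apply: hK | apply: hL] => i iK; apply: hp;
     rewrite leq_max iK ?orbT.
- move=> c d n a b [K hK] [L hL]; exists (maxn K L) => p' hp.
  by apply: (@eval_comp _ _ _ _ a); [apply: hK | apply: hL] => i iK; apply: hp;
     rewrite leq_max iK ?orbT.
- by move=> c d n a [K hK]; exists K => p' hp; constructor; apply: hK.
- move=> c d n k a b [K hK] [L hL]; exists (maxn K L) => p' hp.
  by apply: (@eval_recS _ _ _ _ _ a); [apply: hK | apply: hL] => i iK; apply: hp;
     rewrite leq_max iK ?orbT.
move=> c n k [K hK] hj.
(* The search made [k] earlier evaluations; a common bound for them is a maximum built by induction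
   on [k]. *)
have [L hL] : exists L, forall p', (forall i, (i < L)%N -> p i = p' i) ->
    forall j, (j < k)%N -> exists a, eval p' c (pairn n j) a.+1.
  elim: k hj {hK} => [|k IH] hj; first by exists 0%N.
  have [|L hL] := IH; first by move=> j jk; apply: hj; apply: ltnW.
  have [a [M hM]] := hj k (ltnSn k); exists (maxn L M) => p' hp j.
  rewrite ltnS leq_eqVlt => /orP[/eqP->|jk].
    by exists a; apply: hM => i iM; apply: hp; rewrite leq_max iM orbT.
  by apply: hL jk => i iL; apply: hp; rewrite leq_max iL.
exists (maxn K L) => p' hp; constructor.
  by apply: hK => i iK; apply: hp; rewrite leq_max iK.
by apply: hL => i iL; apply: hp; rewrite leq_max iL orbT.
Qed.

(* Value plus one of [c] on [n] if it is found with all unbounded searches cut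
   off at [t], and 0 otherwise.  The search for [Mu c] carries 0 while it goes
   on, 1 once it is stuck, and [k.+2] once it has succeeded at [k]. *)
Fixpoint run (p : baire) (t : nat) (c : code) (n : nat) : nat :=
  match c with
  | Zero => 1
  | Succ => n.+2
  | Fst => (unpairn n).1.+1
  | Snd => (unpairn n).2.+1
  | Oracle => (p n).+1
  | Pair c d =>
      if run p t c n == 0 then 0
      else if run p t d n == 0 then 0
      else (pairn (run p t c n).-1 (run p t d n).-1).+1
  | Comp c d => if run p t d n == 0 then 0 else run p t c (run p t d n).-1
  | Rec c d =>
      nat_rect (fun=> nat) (run p t c (unpairn n).1)
        (fun k a => if a == 0 then 0
                    else run p t d (pairn (unpairn n).1 (pairn k a.-1)))
        (unpairn n).2
  | Mu c =>
      (nat_rect (fun=> nat) 0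
        (fun k a => if a == 0 then
                      if run p t c (pairn n k) == 0 then 1
                      else if run p t c (pairn n k) == 1 then k.+2 else 0
                    else a) t).-1
  end%N.

Lemma run_sound p t c n a : run p t c n = a.+1 -> eval p c n a.
Proof.
elim: c n a => /=.
- by move=> n a [<-]; constructor.
- by move=> n a [<-]; constructor.
- by move=> n a [<-]; constructor.
- by move=> n a [<-]; constructor.
- by move=> n a [<-]; constructor.
- move=> c IHc d IHd n a; case Ec: (run p t c n) => [|x]//=.
  by case Ed: (run p t d n) => [|y]//= [<-]; constructor; auto.
- move=> c IHc d IHd n a; case Ed: (run p t d n) => [|y]//= Ec.
  by apply: (@eval_comp _ _ _ _ y); auto.
- move=> c IHc d IHd n; rewrite -{4}(unpairnK n); move: (unpairn n) => [u v] /=.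
  elim: v => [|v IHv] a /=; first by move=> ?; constructor; auto.
  set r := nat_rect _ _ _ _ in IHv *.
  case Er: r => [|y]//= Ed.
  by apply: (@eval_recS _ _ _ _ _ y); auto.
- move=> c IHc n a.
  set r := nat_rect _ _ _.
  (* Invariant of the search after [T] steps; the value 1, a stuck search, carries no
     information. *)
  suff H T : (r T = 0%N -> forall j, (j < T)%N -> exists b, eval p c (pairn n j) b.+1)
      /\ (forall k, r T = k.+2 -> eval p (Mu c) n k).
    by case E: (r t) => [//|[//|k]] [<-]; apply: (H t).2.
  elim: T => [|T [IH0 IH1]] /=; first by split.
  rewrite -/r; case: (r T) IH0 IH1 => [|x] IH0 IH1 /=; last first.
    by split=> // k [xk]; apply: IH1; rewrite xk.
  case E: (run p t c (pairn n T)) => [|[|b]] //=; split=> //.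
    by move=> k [<-]; constructor; [apply: IHc | apply: IH0].
  move=> _ j; rewrite ltnS leq_eqVlt => /orP[/eqP->|]; last exact: IH0.
  by exists b; apply: IHc.
Qed.

(** All large cut-offs are needed, not just one, so that the bounds of subcomputations combine by
    maximum. *)
Lemma run_complete p c n a : eval p c n a ->
  exists t0, forall t, (t0 <= t)%N -> run p t c n = a.+1.
Proof.
elim/eval_nested_ind => {c n a}.
1-5: by move=> n; exists 0%N.
- move=> c d n a b [t0 h0] [t1 h1]; exists (maxn t0 t1) => t.
  by rewrite geq_max => /andP[/h0 /= -> /h1 ->].
- move=> c d n a b [t0 h0] [t1 h1]; exists (maxn t0 t1) => t.
  by rewrite geq_max => /andP[/h0 /= -> /h1 /= ->].
- by move=> c d n a [t0 h0]; exists t0 => t /h0; rewrite /= pairnK.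
- move=> c d n k a b [t0 h0] [t1 h1]; exists (maxn t0 t1) => t.
  by rewrite geq_max => /andP[/h0 /= + /h1]; rewrite !pairnK /= => ->.
move=> c n k [t0 h0] hj.
have [t1 h1] : exists t1, forall t, (t1 <= t)%N -> forall j, (j < k)%N ->
    exists b, run p t c (pairn n j) = b.+2.
  elim: k hj {h0} => [|k IH] hj; first by exists 0%N.
  have [|t1 h1] := IH; first by move=> j jk; apply: hj; apply: ltnW.
  have [b [t2 h2]] := hj k (ltnSn k); exists (maxn t1 t2) => t.
  rewrite geq_max => /andP[tt1 tt2] j; rewrite ltnS leq_eqVlt.
  by case/orP=> [/eqP->|jk]; [exists b; apply: h2 | apply: h1].
(* The value [k] is tested at step [k.+1] of the search; afterwards the accumulator no longer
   changes. *)
exists (maxn k.+1 (maxn t0 t1)) => t; rewrite !geq_max => /and3P[kt tt0 tt1] /=.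
set r := nat_rect _ _ _.
have r0 j : (j <= k)%N -> r j = 0%N.
  elim: j => [|j IH]// jk; rewrite /r /= -/r IH 1?ltnW //=.
  by have [b ->] := h1 t tt1 j jk.
suff -> : r t = k.+2 by [].
rewrite -(subnKC kt); elim: (t - k.+1)%N => [|x IH].
  by rewrite addn0 /r /= -/r r0 //= h0.
by rewrite addnS; move: (k.+1 + x)%N IH => y IH; rewrite /r /= -/r IH.
Qed.

(** Determinism comes from [run] being a function: at a common large cut-off it returns both
    values. *)
Lemma eval_det p c n a b : eval p c n a -> eval p c n b -> a = b.
Proof.
move=> /run_complete[t ht] /run_complete[s hs].
have := ht _ (leq_maxl t s); rewrite hs ?leq_maxr // => -[->//].
Qed.

(* [relativise d c] runs [c] with the oracle computed by the section of [d]
   at the first component of the input. *)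
Fixpoint relativise (d c : code) : code :=
  match c with
  | Zero => Comp Zero Snd
  | Succ => Comp Succ Snd
  | Fst => Comp Fst Snd
  | Snd => Comp Snd Snd
  | Oracle => d
  | Pair c1 c2 => Pair (relativise d c1) (relativise d c2)
  | Comp c1 c2 => Comp (relativise d c1) (Pair Fst (relativise d c2))
  | Rec c1 c2 =>
      Comp (Rec (relativise d c1)
                (Comp (relativise d c2)
                      (Pair (Comp Fst Fst) (Pair (Comp Snd Fst) Snd))))
           (Pair (Pair Fst (Comp Fst Snd)) (Comp Snd Snd))
  | Mu c1 =>
      Mu (Comp (relativise d c1) (Pair (Comp Fst Fst) (Pair (Comp Snd Fst) Snd)))
  end.

Lemma eval_fst_eq p s n : eval p Fst (pairn s n) s.
Proof. by have := eval_fst p (pairn s n); rewrite pairnK. Qed.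

Lemma eval_snd_eq p s n : eval p Snd (pairn s n) n.
Proof. by have := eval_snd p (pairn s n); rewrite pairnK. Qed.

Lemma eval_assoc p s n x :
  eval p (Pair (Comp Fst Fst) (Pair (Comp Snd Fst) Snd))
    (pairn (pairn s n) x) (pairn s (pairn n x)).
Proof.
do ?[apply: eval_pair]; last exact: eval_snd_eq.
  by apply: eval_comp (eval_fst_eq _ _ _) (eval_fst_eq _ _ _).
by apply: eval_comp (eval_fst_eq _ _ _) (eval_snd_eq _ _ _).
Qed.

Lemma eval_relativise p q d c s n m :
  (forall i, eval p d (pairn s i) (q i)) -> eval q c n m ->
  eval p (relativise d c) (pairn s n) m.
Proof.
move=> dq; elim/eval_nested_ind => {c n m} /=.
- by move=> n; apply: eval_comp (eval_snd_eq _ _ _) _; constructor.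
- by move=> n; apply: eval_comp (eval_snd_eq _ _ _) _; constructor.
- by move=> n; apply: eval_comp (eval_snd_eq _ _ _) _; constructor.
- by move=> n; apply: eval_comp (eval_snd_eq _ _ _) _; constructor.
- exact: dq.
- by move=> *; apply: eval_pair.
- move=> c e n a b ea cb; apply: eval_comp cb.
  by apply: eval_pair => //; apply: eval_fst_eq.
- move=> c e n a ca; apply: (@eval_comp _ _ _ _ (pairn (pairn s n) 0)).
    apply: eval_pair.
      apply: eval_pair (eval_fst_eq _ _ _) _.
      by apply: eval_comp (eval_snd_eq _ _ _) (eval_fst_eq _ _ _).
    by apply: eval_comp (eval_snd_eq _ _ _) (eval_snd_eq _ _ _).
  by constructor.
- move=> c e n k a b ra eb.
  apply: (@eval_comp _ _ _ _ (pairn (pairn s n) k.+1)).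
    apply: eval_pair.
      apply: eval_pair (eval_fst_eq _ _ _) _.
      by apply: eval_comp (eval_snd_eq _ _ _) (eval_fst_eq _ _ _).
    by apply: eval_comp (eval_snd_eq _ _ _) (eval_snd_eq _ _ _).
  apply: (@eval_recS _ _ _ _ _ a).
    (* The induction hypothesis evaluates a whole [Comp]; inverting it yields the inner [Rec] at
       some input, which determinism identifies with [pairn (pairn s n) k]. *)
    inversion_clear ra.
    have H2 : eval p (Pair (Pair Fst (Comp Fst Snd)) (Comp Snd Snd))
               (pairn s (pairn n k)) (pairn (pairn s n) k).
      apply: eval_pair.
        apply: eval_pair (eval_fst_eq _ _ _) _.
        by apply: eval_comp (eval_snd_eq _ _ _) (eval_fst_eq _ _ _).
      by apply: eval_comp (eval_snd_eq _ _ _) (eval_snd_eq _ _ _).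
    by rewrite -(eval_det H H2).
  by apply: eval_comp (eval_assoc _ _ _ _) eb.
- move=> c n k ck cj; constructor.
    by apply: eval_comp (eval_assoc _ _ _ _) ck.
  move=> j /cj[a ja]; exists a.
  by apply: eval_comp (eval_assoc _ _ _ _) ja.
Qed.

(** Closure properties of this predicate replace the writing of programs. It covers total
    functionals only; unbounded search is treated through stages or an explicit [Mu]. *)
Definition recursive (F : baire -> nat -> nat) : Prop :=
  exists c, forall p n, eval p c n (F p n).

Section Recursive.
Implicit Types F G H : baire -> nat -> nat.

Lemma recursive_ext F G : F =2 G -> recursive F -> recursive G.
Proof. by move=> FG [c hc]; exists c => p n; rewrite -FG. Qed.

(** The pairing is a bijection, so [Pair Fst Snd] is the identity program. *)
Lemma recursive_id : recursive (fun _ e => e).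
Proof.
by exists (Pair Fst Snd) => p n; rewrite -{2}(unpairnK n); repeat constructor.
Qed.

Lemma recursive_succ F : recursive F -> recursive (fun p e => (F p e).+1).
Proof. by move=> [c hc]; exists (Comp Succ c) => p n; repeat econstructor. Qed.

Lemma recursive_const k : recursive (fun _ _ => k).
Proof.
elim: k => [|k IH]; last exact: (recursive_succ IH).
by exists Zero => p n; constructor.
Qed.

Lemma recursive_fst F : recursive F -> recursive (fun p e => (unpairn (F p e)).1).
Proof. by move=> [c hc]; exists (Comp Fst c) => p n; repeat econstructor. Qed.

Lemma recursive_snd F : recursive F -> recursive (fun p e => (unpairn (F p e)).2).
Proof. by move=> [c hc]; exists (Comp Snd c) => p n; repeat econstructor. Qed.

Lemma recursive_oracle F : recursive F -> recursive (fun p e => p (F p e)).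
Proof. by move=> [c hc]; exists (Comp Oracle c) => p n; repeat econstructor. Qed.

Lemma recursive_pairn F G :
  recursive F -> recursive G -> recursive (fun p e => pairn (F p e) (G p e)).
Proof. by move=> [c hc] [d hd]; exists (Pair c d) => p n; constructor. Qed.

Lemma recursive_comp F G :
  recursive F -> recursive G -> recursive (fun p e => F p (G p e)).
Proof. by move=> [c hc] [d hd]; exists (Comp c d) => p n; econstructor. Qed.

Lemma recursive_comp2 (F : baire -> nat -> nat -> nat) G H :
  recursive (fun p e => F p (unpairn e).1 (unpairn e).2) ->
  recursive G -> recursive H -> recursive (fun p e => F p (G p e) (H p e)).
Proof.
move=> rF rG rH; apply: recursive_ext (recursive_comp rF (recursive_pairn rG rH)).
by move=> p e /=; rewrite pairnK.
Qed.

Lemma recursive_nat_rect F (S : baire -> nat -> nat -> nat -> nat) G :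
  recursive F ->
  recursive (fun p e => S p (unpairn e).1 (unpairn (unpairn e).2).1
                              (unpairn (unpairn e).2).2) ->
  recursive G ->
  recursive (fun p e => nat_rect (fun=> nat) (F p e) (S p e) (G p e)).
Proof.
move=> [c hc] [d hd] [g hg].
exists (Comp (Rec c d) (Pair (Pair Fst Snd) g)) => p n.
apply: (@eval_comp _ _ _ _ (pairn n (G p n))).
  by apply: eval_pair => //; rewrite -{2}(unpairnK n); repeat constructor.
elim: (G p n) => [|k IH] /=; first by constructor.
apply: eval_recS IH _.
by have := hd p (pairn n (pairn k (nat_rect (fun=> nat) (F p n) (S p n) k)));
   rewrite !pairnK.
Qed.
End Recursive.

(** * Arithmetic and decidable tests *)

Section Arithmetic.
Implicit Types F G K : baire -> nat -> nat.

Lemma recursive_predn F : recursive F -> recursive (fun p e => (F p e).-1).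
Proof.
move=> rF; have := recursive_nat_rect
  (S := fun _ _ k _ => k) (recursive_const 0)
  (recursive_fst (recursive_snd recursive_id)) rF.
by apply: recursive_ext => p e;
   case: (F p e).
Qed.

Lemma recursive_addn F G :
  recursive F -> recursive G -> recursive (fun p e => F p e + G p e)%N.
Proof.
move=> rF rG; have := recursive_nat_rect
  (S := fun _ _ _ a => a.+1) rF
  (recursive_succ (recursive_snd (recursive_snd recursive_id))) rG.
apply: recursive_ext => p e.
by elim: (G p e) => [|k /= ->]; rewrite ?addn0 ?addnS.
Qed.

Lemma recursive_subn F G :
  recursive F -> recursive G -> recursive (fun p e => F p e - G p e)%N.
Proof.
move=> rF rG; have := recursive_nat_rect
  (S := fun _ _ _ a => a.-1) rF
  (recursive_predn (recursive_snd (recursive_snd recursive_id))) rG.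
apply: recursive_ext => p e.
by elim: (G p e) => [|k /= ->]; rewrite ?subn0 ?subnS.
Qed.

Lemma recursive_muln F G :
  recursive F -> recursive G -> recursive (fun p e => F p e * G p e)%N.
Proof.
move=> rF rG; have := recursive_nat_rect
  (S := fun p e _ a => (F p e + a)%N) (recursive_const 0) (recursive_addn
  (recursive_comp rF (recursive_fst recursive_id))
  (recursive_snd (recursive_snd recursive_id))) rG.
apply: recursive_ext => p e.
by elim: (G p e) => [|k /= ->]; rewrite ?muln0 ?mulnS.
Qed.

Lemma recursive_expn F G :
  recursive F -> recursive G -> recursive (fun p e => F p e ^ G p e)%N.
Proof.
move=> rF rG; have := recursive_nat_rect
  (S := fun p e _ a => (F p e * a)%N) (recursive_const 1) (recursive_muln
  (recursive_comp rF (recursive_fst recursive_id))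
  (recursive_snd (recursive_snd recursive_id))) rG.
apply: recursive_ext => p e.
by elim: (G p e) => [|k /= ->]; rewrite ?expn0 ?expnS.
Qed.

Lemma recursive_if (b : baire -> nat -> bool) F G :
  recursive (fun p e => b p e : nat) -> recursive F -> recursive G ->
  recursive (fun p e => if b p e then F p e else G p e).
Proof.
move=> rb rF rG; have := recursive_nat_rect
  (S := fun p e _ _ => F p e) rG
  (recursive_comp rF (recursive_fst recursive_id)) rb.
by apply: recursive_ext => p e; case: (b p e).
Qed.

Lemma recursive_leq F G :
  recursive F -> recursive G -> recursive (fun p e => (F p e <= G p e)%N : nat).
Proof.
move=> rF rG; have := recursive_subn (recursive_const 1) (recursive_subn rF rG).
by apply: recursive_ext => p e; rewrite /leq; case: (F p e - G p e)%N.
Qed.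

Lemma recursive_negb (b : baire -> nat -> bool) :
  recursive (fun p e => b p e : nat) -> recursive (fun p e => ~~ b p e : nat).
Proof.
move=> rb; have := recursive_if rb (recursive_const 0) (recursive_const 1).
by apply: recursive_ext => p e; case: (b p e).
Qed.

Lemma recursive_andb (b c : baire -> nat -> bool) :
  recursive (fun p e => b p e : nat) -> recursive (fun p e => c p e : nat) ->
  recursive (fun p e => b p e && c p e : nat).
Proof.
move=> rb rc; have := recursive_if rb rc (recursive_const 0).
by apply: recursive_ext => p e; case: (b p e).
Qed.

Lemma recursive_orb (b c : baire -> nat -> bool) :
  recursive (fun p e => b p e : nat) -> recursive (fun p e => c p e : nat) ->
  recursive (fun p e => b p e || c p e : nat).
Proof.
move=> rb rc; have := recursive_if rb (recursive_const 1) rc.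
by apply: recursive_ext => p e; case: (b p e).
Qed.

Lemma recursive_eqn F G :
  recursive F -> recursive G -> recursive (fun p e => (F p e == G p e) : nat).
Proof.
move=> rF rG; have := recursive_andb (recursive_leq rF rG) (recursive_leq rG rF).
by apply: recursive_ext => p e; rewrite eqn_leq.
Qed.

Lemma recursive_odd F : recursive F -> recursive (fun p e => odd (F p e) : nat).
Proof.
move=> rF; have := recursive_nat_rect
  (S := fun _ _ _ a => (1 - a)%N) (recursive_const 0) (recursive_subn
  (recursive_const 1) (recursive_snd (recursive_snd recursive_id))) rF.
apply: recursive_ext => p e.
by elim: (F p e) => [|k /= ->] //; case: (odd k).
Qed.

Lemma recursive_half F : recursive F -> recursive (fun p e => (F p e)./2).
Proof.
move=> rF; have := recursive_nat_rect
  (S := fun _ _ k a => (odd k + a)%N) (recursive_const 0) (recursive_addn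
  (recursive_odd (recursive_fst (recursive_snd recursive_id)))
  (recursive_snd (recursive_snd recursive_id))) rF.
apply: recursive_ext => p e.
by elim: (F p e) => [|k /= ->] //; rewrite uphalf_half.
Qed.

Lemma recursive_all (b : baire -> nat -> nat -> bool) K :
  recursive (fun p e => b p (unpairn e).1 (unpairn e).2 : nat) -> recursive K ->
  recursive (fun p e => all (b p e) (iota 0 (K p e)) : nat).
Proof.
move=> rb rK; have rb' := recursive_comp2 (F := b) rb
  (recursive_fst recursive_id) (recursive_fst (recursive_snd recursive_id)).
have := recursive_nat_rect
  (S := fun p e j a => if b p e j then a else 0%N) (recursive_const 1)
  (recursive_if rb'
   (recursive_snd (recursive_snd recursive_id)) (recursive_const 0)) rK.
apply: recursive_ext => p e.
elim: (K p e) => [|k IH] //.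
by rewrite -[in RHS]addn1 iotaD all_cat /= IH andbT andbC; case: (b p e k).
Qed.

End Arithmetic.

(** Every number is read as nested pairs and so codes a word of every length; the intended length is
    kept separately. *)
Definition nthn (w i : nat) : nat := (unpairn (iter i (fun x => (unpairn x).2) w)).1.

Lemma nthn_surj (f : nat -> nat) l :
  exists w, forall i, (i < l)%N -> nthn w i = f i.
Proof.
elim: l f => [|l IH] f; first by exists 0%N.
have [w hw] := IH (fun i => f i.+1); exists (pairn (f 0%N) w) => -[|i] il.
  by rewrite /nthn /= pairnK.
by rewrite -hw // /nthn iterSr pairnK.
Qed.

Lemma nthn0 i : nthn 0 i = 0%N.
Proof.
suff h : iter i (fun x => (unpairn x).2) 0%N = 0%N by rewrite /nthn h unpairn0.
elim: i => [|i IH]; first by [].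
by rewrite iterS IH unpairn0.
Qed.

Lemma recursive_nthn F G : recursive F -> recursive G ->
  recursive (fun p e => nthn (F p e) (G p e)).
Proof.
move=> rF rG; have := recursive_fst (recursive_nat_rect
  (S := fun _ _ _ a => (unpairn a).2) rF
  (recursive_snd (recursive_snd (recursive_snd recursive_id))) rG).
apply: recursive_ext => p e.
rewrite /nthn; set x := nat_rect _ _ _ _.
suff -> : x = iter (G p e) (fun a => (unpairn a).2) (F p e) by [].
by rewrite /x; elim: (G p e) => [|k IH]; [|rewrite iterS -IH].
Qed.

(* Matching syntactically keeps unification from unfolding the arithmetic. *)
Ltac recursive_step :=
  match goal with
  | |- recursive (fun _ e => e) => exact: recursive_id
  | |- recursive (fun _ _ => ?k) => exact: (recursive_const k)
  | |- recursive (fun p e => (unpairn (@?F p e)).1) => refine (@recursive_fst F _)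
  | |- recursive (fun p e => (unpairn (@?F p e)).2) => refine (@recursive_snd F _)
  | |- recursive (fun p e => pairn (@?F p e) (@?G p e)) =>
      refine (@recursive_pairn F G _ _)
  | |- recursive (fun p e => nat_of_bool (leq (@?F p e) (@?G p e))) =>
      refine (@recursive_leq F G _ _)
  | |- recursive (fun p e => nat_of_bool ((@?F p e) == (@?G p e))) =>
      refine (@recursive_eqn F G _ _)
  | |- recursive (fun p e => nat_of_bool ((@?F p e) && (@?G p e))) =>
      refine (@recursive_andb F G _ _)
  | |- recursive (fun p e => nat_of_bool ((@?F p e) || (@?G p e))) =>
      refine (@recursive_orb F G _ _)
  | |- recursive (fun p e => nat_of_bool (~~ (@?F p e))) =>
      refine (@recursive_negb F _)
  | |- recursive (fun p e => nat_of_bool (odd (@?F p e))) =>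
      refine (@recursive_odd F _)
  | |- recursive (fun p e => nat_of_bool (all (@?F p e) (iota 0 (@?G p e)))) =>
      refine (@recursive_all F G _ _)
  | |- recursive (fun p e => predn (@?F p e)) => refine (@recursive_predn F _)
  | |- recursive (fun p e => half (@?F p e)) => refine (@recursive_half F _)
  | |- recursive (fun p e => nthn (@?F p e) (@?G p e)) =>
      refine (@recursive_nthn F G _ _)
  | |- recursive (fun p e => addn (@?F p e) (@?G p e)) =>
      refine (@recursive_addn F G _ _)
  | |- recursive (fun p e => subn (@?F p e) (@?G p e)) =>
      refine (@recursive_subn F G _ _)
  | |- recursive (fun p e => muln (@?F p e) (@?G p e)) =>
      refine (@recursive_muln F G _ _)
  | |- recursive (fun p e => expn (@?F p e) (@?G p e)) =>
      refine (@recursive_expn F G _ _)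
  | |- recursive (fun p e => nat_rect _ (@?F p e) (@?S p e) (@?G p e)) =>
      refine (@recursive_nat_rect F S G _ _ _)
  | |- recursive (fun p e => S (@?F p e)) => refine (@recursive_succ F _)
  | H : recursive ?F |- recursive ?G => constr_eq F G; exact: H
  | |- recursive (fun p e => nat_of_bool (@?F p e)) => fail 1
  | |- recursive _ => first
      [ refine (recursive_oracle _) | refine (recursive_if _ _ _) ]
  end; cbv beta.

Ltac recursive_tac := repeat recursive_step.

(** For a fixed program the cut-off bounds every search, which leaves only primitive recursion in
    the oracle. *)
Lemma recursive_run c :
  recursive (fun p e => run p (unpairn e).1 c (unpairn e).2).
Proof.
elim: c => [||||| c IHc d IHd | c IHc d IHd | c IHc d IHd | c IHc] /=;
  try by recursive_tac.
- recursive_tac.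
  by apply: (recursive_comp2 (F := fun p t => run p t c)); recursive_tac.
- recursive_tac.
    by apply: (recursive_comp2 (F := fun p t => run p t c)); recursive_tac.
  by apply: (recursive_comp2 (F := fun p t => run p t d)); recursive_tac.
- recursive_tac;
  by apply: (recursive_comp2 (F := fun p t => run p t c)); recursive_tac.
Qed.

(** With [G] constantly zero, a test run on the zero oracle becomes a functional of an arbitrary
    oracle. *)
Lemma recursive_relativise F (G : baire -> nat -> baire) :
  recursive F -> recursive (fun p e => G p (unpairn e).1 (unpairn e).2) ->
  recursive (fun p e => F (G p (unpairn e).1) (unpairn e).2).
Proof.
move=> [c hc] [d hd]; exists (relativise d c) => p e; rewrite -{1}(unpairnK e).
apply: eval_relativise (hc (G p (unpairn e).1) _) => i.
by have := hd p (pairn (unpairn e).1 i); rewrite pairnK.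
Qed.

Lemma computes_relativise c (G : baire -> nat -> baire) :
  recursive (fun p e => G p (unpairn e).1 (unpairn e).2) ->
  exists c', forall p s q, computes c (G p s) q ->
    forall n, eval p c' (pairn s n) (q n).
Proof.
move=> [d hd]; exists (relativise d c) => p s q cq n.
apply: eval_relativise (cq n) => i.
by have := hd p (pairn s i); rewrite pairnK.
Qed.

(** * Pairs of names, composition and reduction of operations *)

Definition join (p q : baire) : baire :=
  fun n => if odd n then q n./2 else p n./2.

Lemma evens_join p q : evens (join p q) = p.
Proof. by apply/funext => i; rewrite /evens /join mul2n odd_double doubleK. Qed.

Lemma odds_join p q : odds (join p q) = q.
Proof.
by apply/funext => i; rewrite /odds /join mul2n addn1 /= odd_double uphalf_double.
Qed.

Lemma computes_recursive F : recursive F -> exists c, forall p, computes c p (F p).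
Proof. by move=> [c hc]; exists c => p n. Qed.

Lemma eval_id p n : eval p (Pair Fst Snd) n n.
Proof. by rewrite -{2}(unpairnK n); repeat constructor. Qed.

Lemma computes_comp c d :
  exists c', forall p q r, computes c p q -> computes d q r -> computes c' p r.
Proof.
(* [relativise] expects an oracle with a parameter; here the parameter is a dummy 0, discarded by
   [Comp c Snd]. *)
exists (Comp (relativise (Comp c Snd) d) (Pair Zero (Pair Fst Snd))) => p q r cq dr n.
apply: (@eval_comp _ _ _ _ (pairn 0 n)).
  by apply: eval_pair (eval_id _ _); constructor.
apply: eval_relativise (dr n) => i.
by apply: eval_comp (cq i); apply: eval_snd_eq.
Qed.

Lemma computes_join c d :
  exists c', forall p q r, computes c p q -> computes d p r ->
    computes c' p (join q r).
Proof.
have [e he] : recursive (fun _ e => if odd (unpairn e).1 then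
   (unpairn (unpairn e).2).2 else (unpairn (unpairn e).2).1) by recursive_tac.
have [h hh] : recursive (fun _ e => e./2) by recursive_tac.
exists (Comp e (Pair (Pair Fst Snd) (Pair (Comp c h) (Comp d h)))) => p q r cq dr n.
apply: (@eval_comp _ _ _ _ (pairn n (pairn (q n./2) (r n./2)))); last first.
  by have := he p (pairn n (pairn (q n./2) (r n./2))); rewrite !pairnK.
apply: eval_pair (eval_id _ _) _.
by apply: eval_pair; [apply: eval_comp (cq _) | apply: eval_comp (dr _)];
   apply: hh.
Qed.

Section Operations.
Variables (X Y Z : Type) (dX : representation X) (dY : representation Y)
  (dZ : representation Z).

Lemma computable_comp (f : operation X Y) (g : operation Y Z) :
  computable dX dY f -> computable dY dZ g -> computable dX dZ (op_comp g f).
Proof.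
move=> [c hc] [d hd]; have [c' hc'] := computes_comp c d.
exists c' => p x px [fx fg].
have [q [cq [y [qy fy]]]] := hc p x px fx.
have [r [dr [z [rz gz]]]] := hd q y qy (fg y fy).
by exists r; split; [apply: hc' cq dr | exists z; split=> //; exists y].
Qed.

Lemma computable_recursive (G : baire -> baire) (f : operation X Y) :
  recursive (fun p e => G p e) ->
  (forall p x, dX p x -> op_dom f x -> exists2 y, dY (G p) y & op_val f x y) ->
  computable dX dY f.
Proof.
move=> /computes_recursive[c hc] hG; exists c => p x px fx.
have [y yG fy] := hG p x px fx.
by exists (G p); split => //; exists y.
Qed.

End Operations.

(** A Weihrauch reduction of [g] to [f]: [G] prepares an instance of [f], and [H] converts the
    answer while still seeing the original name in the even half. *)
Lemma computable_reduce (X Y X' Y' : Type) (dX : representation X)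
    (dY : representation Y) (dX' : representation X') (dY' : representation Y')
    (G H : baire -> baire) (f : operation X Y) (g : operation X' Y') :
  recursive (fun p e => G p e) -> recursive (fun p e => H p e) ->
  (forall p x', dX' p x' -> op_dom g x' ->
    exists x, [/\ dX (G p) x, op_dom f x & forall q y, dY q y -> op_val f x y ->
      exists2 y', dY' (H (join p q)) y' & op_val g x' y']) ->
  computable dX dY f -> computable dX' dY' g.
Proof.
move=> /computes_recursive[a ha] /computes_recursive[b hb] red [c hc].
have [d1 hd1] := computes_comp a c.
have [d2 hd2] := computes_join (Pair Fst Snd) (Comp Oracle (Pair Fst Snd)).
have [i hi] := @computes_recursive (fun p e => p e) ltac:(by recursive_tac).
have [d3 hd3] := computes_join i d1.
have [d4 hd4] := computes_comp d3 b.
exists d4 => p x' px' gx'.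
have [x [Gx fx val]] := red p x' px' gx'.
have [q [cq [y [qy fy]]]] := hc _ _ Gx fx.
have [y' Hy' gy'] := val q y qy fy.
exists (H (join p q)); split; last by exists y'.
by apply: hd4 (hb _); apply: hd3 (hi p) _; apply: hd1 (ha p) cq.
Qed.

(** * Semidecidable predicates *)

Definition semidecidable (P : baire -> nat -> Prop) : Prop :=
  exists T : baire -> nat -> nat -> bool,
    recursive (fun p e => T p (unpairn e).1 (unpairn e).2 : nat) /\
    forall p n, P p n <-> exists t, T p n t.

Section Semidecidable.
Implicit Types P Q : baire -> nat -> Prop.

Lemma semidecidable_ext P Q :
  (forall p n, P p n <-> Q p n) -> semidecidable P -> semidecidable Q.
Proof.
by move=> PQ [T [rT hT]]; exists T; split=> // p n; rewrite -PQ.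
Qed.

Lemma semidecidable_bool (b : baire -> nat -> bool) :
  recursive (fun p e => b p e : nat) -> semidecidable (fun p e => b p e).
Proof.
move=> rb; exists (fun p n _ => b p n); split; last first.
  by move=> p n; split=> [|[]//]; exists 0%N.
by apply: (recursive_comp rb); recursive_tac.
Qed.

Lemma semidecidable_and P Q : semidecidable P -> semidecidable Q ->
  semidecidable (fun p e => P p e /\ Q p e).
Proof.
move=> [T [rT hT]] [U [rU hU]].
exists (fun p n t => T p n (unpairn t).1 && U p n (unpairn t).2); split.
  recursive_tac.
    by apply: (recursive_comp2 (F := fun p a t => T p a t : nat) rT); recursive_tac.
  by apply: (recursive_comp2 (F := fun p a t => U p a t : nat) rU); recursive_tac.
move=> p n; rewrite hT hU; split=> [[[t ht] [u hu]]|[t /andP[ht hu]]].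
  by exists (pairn t u); rewrite pairnK ht.
by split; eexists; eassumption.
Qed.

Lemma semidecidable_or P Q : semidecidable P -> semidecidable Q ->
  semidecidable (fun p e => P p e \/ Q p e).
Proof.
move=> [T [rT hT]] [U [rU hU]]; exists (fun p n t => T p n t || U p n t).
split; first by recursive_tac.
move=> p n; rewrite hT hU; split=> [[[t ht]|[t ht]]|[t /orP[ht|ht]]].
- by exists t; rewrite ht.
- by exists t; rewrite ht orbT.
- by left; exists t.
- by right; exists t.
Qed.

(** Dovetailing: one stage codes a witness together with a stage of its test. *)
Lemma semidecidable_ex (P : baire -> nat -> nat -> Prop) :
  semidecidable (fun p e => P p (unpairn e).1 (unpairn e).2) ->
  semidecidable (fun p e => exists k, P p e k).
Proof.
move=> [T [rT hT]].
exists (fun p n t => T p (pairn n (unpairn t).1) (unpairn t).2); split.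
  by apply: (recursive_comp2 (F := fun p a t => T p a t : nat) rT); recursive_tac.
move=> p n; split=> [[k Pk]|[t ht]].
  have [|t ht] := (hT p (pairn n k)).1; first by rewrite pairnK.
  by exists (pairn k t); rewrite pairnK.
exists (unpairn t).1; have := (hT p (pairn n (unpairn t).1)).2.
by rewrite pairnK; apply; exists (unpairn t).2.
Qed.

(** Finitely many tests succeed at finitely many stages, and one stage can code the word of all of
    them. *)
Lemma semidecidable_forall_lt (P : baire -> nat -> nat -> Prop) K :
  semidecidable (fun p e => P p (unpairn e).1 (unpairn e).2) -> recursive K ->
  semidecidable (fun p e => forall j, (j < K p e)%N -> P p e j).
Proof.
move=> [T [rT hT]] rK.
exists (fun p n t => all (fun j => T p (pairn n j) (nthn t j)) (iota 0 (K p n))).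
split.
  recursive_tac; last by apply: (recursive_comp rK); recursive_tac.
  by apply: (recursive_comp2 (F := fun p a t => T p a t : nat) rT); recursive_tac.
move=> p n; split=> [PK|[t /allP ht] j jK]; last first.
  have := (hT p (pairn n j)).2; rewrite pairnK; apply.
  by exists (nthn t j); apply: ht; rewrite mem_iota.
have /choice[f hf] : forall j, exists t, (j < K p n)%N -> T p (pairn n j) t.
  move=> j; have [jK|] := ltnP j (K p n); last by exists 0%N.
  by have [|t] := (hT p (pairn n j)).1; [rewrite pairnK; apply: PK | exists t].
have [w hw] := nthn_surj f (K p n).
exists w; apply/allP => j; rewrite mem_iota => /= jK.
by rewrite hw //; apply: hf.
Qed.

End Semidecidable.

(** Halting is observed through [run], whose cut-off serves as the stage. *)
Lemma ce_rel_stages (S : nat -> nat -> Prop) : ce_rel S ->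
  exists T : nat -> nat -> nat -> bool,
    recursive (fun _ e => T (unpairn e).1 (unpairn (unpairn e).2).1
                            (unpairn (unpairn e).2).2 : nat) /\
    forall m n, S m n <-> exists t, T m n t.
Proof.
move=> [c hc].
exists (fun m n t => (0 < run (fun=> 0%N) t c (pairn m n))%N); split.
  have r0 := recursive_relativise (G := fun _ _ _ => 0%N) (recursive_run c)
    (recursive_const 0).
  recursive_tac; apply: (recursive_ext _ (recursive_comp r0
    (_ : recursive (fun _ e => pairn 0 (pairn (unpairn (unpairn e).2).2
      (pairn (unpairn e).1 (unpairn (unpairn e).2).1)))))); last by recursive_tac.
  by move=> p e; rewrite !pairnK.
move=> m n; rewrite hc; split=> [[k /run_complete[t ht]]|[t]].
  by exists t; rewrite ht.
by case E: run => [|k]// _; exists k; apply: run_sound E.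
Qed.

(** * Ideal balls and names of open sets *)

Import Order.TTheory GRing.Theory Num.Theory.
Local Open Scope ring_scope.

(** This makes the answers of a realiser on a recursive sequence of names one recursive double
    sequence. *)
Lemma recursive_of_computes c (G Q : nat -> baire) :
  recursive (fun _ e => G (unpairn e).1 (unpairn e).2) ->
  (forall m, computes c (G m) (Q m)) ->
  recursive (fun _ e => Q (unpairn e).1 (unpairn e).2).
Proof.
move=> rG cQ; have [c' hc'] := computes_relativise c (G := fun _ => G) rG.
by exists c' => p e; rewrite -{1}(unpairnK e); apply: hc'.
Qed.

(** * Comparing reals through rational approximations *)

Section Approximation.
Variable R : realType.
Implicit Types (x : R) (m k z s t : nat).

(** The inequality of [approx_ltE] multiplied by [C * 2 ^ k], with the negative term moved across,
    so that only natural numbers are compared. [approx_gt] is obtained in the same way from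
    [approx_gtE]. *)
Definition approx_lt m k z s t : bool :=
  let A := (unpairn (unpairn m).1).1 in let B := (unpairn (unpairn m).1).2 in
  let C := (unpairn m).2.+1 in
  (A * 2 ^ k * z + C * z + s * (C * 2 ^ k) < t * (C * 2 ^ k) + B * 2 ^ k * z)%N.

Definition approx_gt m k z s : bool :=
  let A := (unpairn (unpairn m).1).1 in let B := (unpairn (unpairn m).1).2 in
  let C := (unpairn m).2.+1 in
  (s * (C * 2 ^ k) + C * z + B * 2 ^ k * z < A * 2 ^ k * z)%N.

Lemma approx_ltE m k z s t :
  approx_lt m k z s t = ((nuQ R m + 2 ^- k) * z%:R + s%:R < t%:R).
Proof.
rewrite /approx_lt /nuQ [unpairn m]surjective_pairing
  [unpairn (unpairn m).1]surjective_pairing /=.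
set A := (unpairn (unpairn m).1).1; set B := (unpairn (unpairn m).1).2.
set C := (unpairn m).2.+1.
have C0 : (C%:R : R) != 0 by rewrite pnatr_eq0.
have k0 : (2 : R) ^+ k != 0 by rewrite expf_neq0 // pnatr_eq0.
have Ck : 0 < (C%:R * 2 ^+ k : R) by rewrite mulr_gt0 ?ltr0n // exprn_gt0.
clearbody C.
rewrite -(ltr_pM2r Ck) -(ltr_nat R) !natrD !natrM !natrX.
rewrite -subr_gt0 -[RHS]subr_gt0; congr (0 < _); field.
by rewrite k0 C0.
Qed.

Lemma approx_gtE m k z s :
  approx_gt m k z s = (s%:R < (nuQ R m - 2 ^- k) * z%:R).
Proof.
rewrite /approx_gt /nuQ [unpairn m]surjective_pairing
  [unpairn (unpairn m).1]surjective_pairing /=.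
set A := (unpairn (unpairn m).1).1; set B := (unpairn (unpairn m).1).2.
set C := (unpairn m).2.+1.
have C0 : (C%:R : R) != 0 by rewrite pnatr_eq0.
have k0 : (2 : R) ^+ k != 0 by rewrite expf_neq0 // pnatr_eq0.
have Ck : 0 < (C%:R * 2 ^+ k : R) by rewrite mulr_gt0 ?ltr0n // exprn_gt0.
clearbody C.
rewrite -(ltr_pM2r Ck) -(ltr_nat R) !natrD !natrM !natrX.
rewrite -subr_gt0 -[RHS]subr_gt0; congr (0 < _); field.
by rewrite k0 C0.
Qed.

Lemma exp2_small (e : R) : 0 < e -> exists k, 2 ^- k < e.
Proof.
move=> e0; have [N _ hN] := near_infty_natSinv_expn_lt (PosNum e0).
by exists N; rewrite -div1r; apply: hN => /=.
Qed.

Lemma exp2_le k l : (k <= l)%N -> (2 ^- l : R) <= 2 ^- k.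
Proof.
by move=> kl; rewrite lef_pV2 ?posrE ?exprn_gt0 // ler_eXn2l // ltr1n.
Qed.

Lemma exp2_gt0 k : 0 < (2 ^- k : R).
Proof. by rewrite invr_gt0 exprn_gt0. Qed.

Lemma exp2_half k : (2 ^- k.+1 : R) = 2 ^- k / 2.
Proof. by rewrite exprS invfM mulrC. Qed.

Lemma approx_lt_ex x (f : nat -> nat) z s t :
  (forall k, `|x - nuQ R (f k)| < 2 ^- k) ->
  (x * z%:R + s%:R < t%:R) <-> exists k, approx_lt (f k) k z s t.
Proof.
move=> hf; have z0 : 0 <= z%:R :> R by [].
split=> [lt|[k]].
  (* The approximation plus [2 ^- k] exceeds [x] by less than [2 * 2 ^- k], and [z] scales this
     error; the summand 1 keeps the divisor positive when [z] is 0. *)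
  have [k hk] : exists k, 2 ^- k < (t%:R - (x * z%:R + s%:R)) / (2 * z%:R + 1).
    by apply: exp2_small; rewrite divr_gt0 ?subr_gt0 //; lra.
  exists k; rewrite approx_ltE; have := hf k; rewrite ltr_norml => /andP[h _].
  move: hk; rewrite ltr_pdivlMr; last by lra.
  have := exp2_gt0 k; move: (2 ^- k) (nuQ _ _) h => u v h u0 hk.
  have : v * z%:R <= (x + u) * z%:R by apply: ler_wpM2r => //; lra.
  by rewrite !mulrDl mulrDr mulr1 in hk *; lra.
rewrite approx_ltE; apply: le_lt_trans; rewrite lerD2r; apply: ler_wpM2r => //.
by have := hf k; rewrite ltr_norml => /andP[_]; lra.
Qed.

Lemma approx_gt_ex x (f : nat -> nat) z s :
  (forall k, `|x - nuQ R (f k)| < 2 ^- k) ->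
  (s%:R < x * z%:R) <-> exists k, approx_gt (f k) k z s.
Proof.
move=> hf; have z0 : 0 <= z%:R :> R by [].
split=> [lt|[k]].
  have [k hk] : exists k, 2 ^- k < (x * z%:R - s%:R) / (2 * z%:R + 1).
    by apply: exp2_small; rewrite divr_gt0 ?subr_gt0 //; lra.
  exists k; rewrite approx_gtE; have := hf k; rewrite ltr_norml => /andP[_ h].
  move: hk; rewrite ltr_pdivlMr; last by lra.
  have := exp2_gt0 k; move: (2 ^- k) (nuQ _ _) h => u v h u0 hk.
  have : (x - u) * z%:R <= v * z%:R by apply: ler_wpM2r => //; lra.
  by rewrite !mulrDl mulrDr mulr1 !mulNr in hk *; lra.
rewrite approx_gtE => /lt_le_trans; apply; apply: ler_wpM2r => //.
by have := hf k; rewrite ltr_norml => /andP[+ _]; lra.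
Qed.

End Approximation.

Section Metric.
Variables (R : realType) (X : computableMetricSpace R).
Local Notation alphaX := (@alpha R X).
Local Notation openX := (@named_open R X).
Local Notation d i j := (mdist (nu X i) (nu X j)).

(** The chosen approximations are all outputs of one program, so the choice function is itself
    recursive. *)
Lemma dist_approximation : exists D : nat -> nat -> nat -> nat,
  recursive (fun _ e => D (unpairn e).1 (unpairn (unpairn e).2).1
                          (unpairn (unpairn e).2).2) /\
  forall i j k, `|d i j - nuQ R (D i j k)| < 2 ^- k.
Proof.
have [c hc] := nu_computable X.
have /choice[f hf] : forall n, exists m, eval0 c n m /\
    `|d (unpairn n).1 (unpairn (unpairn n).2).1 - nuQ R m|
      < 2 ^- (unpairn (unpairn n).2).2.
  move=> n; have := hc (unpairn n).1 (unpairn (unpairn n).2).1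
    (unpairn (unpairn n).2).2; by rewrite !unpairnK.
exists (fun i j k => f (pairn i (pairn j k))); split; last first.
  by move=> i j k; have := (hf (pairn i (pairn j k))).2; rewrite !pairnK.
have rf := @recursive_of_computes c (fun _ _ => 0%N) (fun _ => f)
  (recursive_const 0) (fun _ n => (hf n).1).
apply: recursive_ext (recursive_comp rf
  (recursive_pairn (recursive_const 0) recursive_id)) => p e /=.
by rewrite pairnK /= !unpairnK.
Qed.

Section Comparison.
Variables I J Z S T : baire -> nat -> nat.
Hypotheses (rI : recursive I) (rJ : recursive J) (rZ : recursive Z)
  (rS : recursive S) (rT : recursive T).

Let rfst F (rF : recursive F) := recursive_comp rF (recursive_fst recursive_id).

(** With denominators cleared, membership in a ball, formal inclusion and the Cauchy condition all
    take this affine form. *)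
Lemma semidecidable_dist_lt : semidecidable (fun p e =>
  d (I p e) (J p e) * (Z p e)%:R + (S p e)%:R < (T p e)%:R).
Proof.
have [D [rD hD]] := dist_approximation.
apply: (semidecidable_ext (P := fun p e => exists k,
  approx_lt (D (I p e) (J p e) k) k (Z p e) (S p e) (T p e))).
  by move=> p e; rewrite (approx_lt_ex _ _ _ (hD (I p e) (J p e))).
apply: semidecidable_ex; apply: semidecidable_bool; rewrite /approx_lt.
have [rI' rJ' rZ' rS' rT'] := And5 (rfst rI) (rfst rJ) (rfst rZ) (rfst rS) (rfst rT).
have rD' : recursive (fun p e => D (I p (unpairn e).1) (J p (unpairn e).1) (unpairn e).2).
  have r : recursive (fun p e => pairn (I p (unpairn e).1)
     (pairn (J p (unpairn e).1) (unpairn e).2)) by recursive_tac.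
  by apply: recursive_ext (recursive_comp rD r) => p e; rewrite !pairnK.
by recursive_tac.
Qed.

Lemma semidecidable_dist_gt : semidecidable (fun p e =>
  (S p e)%:R < d (I p e) (J p e) * (Z p e)%:R).
Proof.
have [D [rD hD]] := dist_approximation.
apply: (semidecidable_ext (P := fun p e => exists k,
  approx_gt (D (I p e) (J p e) k) k (Z p e) (S p e))).
  by move=> p e; rewrite (approx_gt_ex _ _ (hD (I p e) (J p e))).
apply: semidecidable_ex; apply: semidecidable_bool; rewrite /approx_gt.
have [rI' rJ' rZ' rS'] := And4 (rfst rI) (rfst rJ) (rfst rZ) (rfst rS).
have rD' : recursive (fun p e => D (I p (unpairn e).1) (J p (unpairn e).1) (unpairn e).2).
  have r : recursive (fun p e => pairn (I p (unpairn e).1)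
     (pairn (J p (unpairn e).1) (unpairn e).2)) by recursive_tac.
  by apply: recursive_ext (recursive_comp rD r) => p e; rewrite !pairnK.
by recursive_tac.
Qed.

End Comparison.

Definition alpha_center n := (unpairn n).1.
Definition alpha_radius n : R := nuQpos R (unpairn n).2.
Definition alpha_radius_num n := (unpairn (unpairn n).2).1.+1.
Definition alpha_radius_den n := (unpairn (unpairn n).2).2.+1.

Lemma radiusE n : alpha_radius n = (alpha_radius_num n)%:R / (alpha_radius_den n)%:R.
Proof. by rewrite /alpha_radius /nuQpos [unpairn _.2]surjective_pairing. Qed.

Lemma alpha_radius_den_gt0 n : 0 < (alpha_radius_den n)%:R :> R.
Proof. by rewrite ltr0n. Qed.

Lemma alphaE n x : alphaX n x = (mdist (nu X (alpha_center n)) x < alpha_radius n) :> Prop.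
Proof.
by rewrite /alpha /alpha_radius /alpha_center [unpairn n]surjective_pairing /= ballEmdist.
Qed.

Lemma semidecidable_mem_alpha F G : recursive F -> recursive G ->
  semidecidable (fun p e => alphaX (G p e) (nu X (F p e))).
Proof.
move=> rF rG; apply: (semidecidable_ext (P := fun p e =>
  d (alpha_center (G p e)) (F p e) * (alpha_radius_den (G p e))%:R + 0%:R
    < (alpha_radius_num (G p e))%:R)).
  by move=> p e; rewrite alphaE radiusE ltr_pdivlMr ?alpha_radius_den_gt0 // addr0.
by apply: semidecidable_dist_lt; rewrite /alpha_center /alpha_radius_num /alpha_radius_den;
   recursive_tac.
Qed.

(* Unlike inclusion of the balls, this is semi-decidable. *)
Definition formally_in n n' : Prop :=
  d (alpha_center n) (alpha_center n') + alpha_radius n < alpha_radius n'.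

Lemma semidecidable_formally_in F G : recursive F -> recursive G ->
  semidecidable (fun p e => formally_in (F p e) (G p e)).
Proof.
move=> rF rG; apply: (semidecidable_ext (P := fun p e =>
  d (alpha_center (F p e)) (alpha_center (G p e)) *
    (alpha_radius_den (F p e) * alpha_radius_den (G p e))%:R +
    (alpha_radius_num (F p e) * alpha_radius_den (G p e))%:R
    < (alpha_radius_num (G p e) * alpha_radius_den (F p e))%:R)).
  move=> p e; rewrite /formally_in !radiusE.
  move: (alpha_center _) (alpha_center _) => i j.
  have /lt0r_neq0 := alpha_radius_den_gt0 (F p e).
  have /lt0r_neq0 := alpha_radius_den_gt0 (G p e).
  have := alpha_radius_den_gt0 (F p e); have := alpha_radius_den_gt0 (G p e).
  rewrite !natrM; move: (alpha_radius_den _)%:R (alpha_radius_den _)%:R => u v u0 v0 un vn.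
  rewrite -[X in _ <-> is_true X](ltr_pM2r (mulr_gt0 u0 v0)).
  by apply: iff_sym; rewrite -subr_gt0 -[X in _ <-> is_true X]subr_gt0;
    match goal with |- is_true (0 < ?a) <-> is_true (0 < ?b) =>
      suff -> : a = b by [] end; field; rewrite un vn.
by apply: semidecidable_dist_lt; rewrite /alpha_center /alpha_radius_num /alpha_radius_den;
   recursive_tac.
Qed.

Lemma formally_in_subset n n' : formally_in n n' -> alphaX n `<=` alphaX n'.
Proof.
move=> nn' x; rewrite !alphaE /formally_in in nn' *.
have := metric_triangle (nu X (alpha_center n')) (nu X (alpha_center n)) x.
by rewrite [mdist (nu X (alpha_center n')) (nu X (alpha_center n))]metric_sym; lra.
Qed.

(** [pairn 0 (2 ^ M).-1] codes the radius [2 ^- M], since [nuQpos] adds one to both components.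
    Statements about all balls small at [x] play the role of neighbourhood statements, and finitely
    many of them can be met at once. *)
Definition small_at (x : X) (N n : nat) : Prop :=
  exists a M, [/\ (N <= M)%N, n = pairn a (pairn 0 (2 ^ M).-1) &
                  mdist (nu X a) x < 2 ^- M].

Lemma radius_small a M : alpha_radius (pairn a (pairn 0 (2 ^ M).-1)) = 2 ^- M.
Proof.
rewrite radiusE /alpha_radius_num /alpha_radius_den !pairnK /= prednK ?expn_gt0 //.
by rewrite div1r natrX.
Qed.

Lemma small_at_ex x N : exists n, small_at x N n.
Proof.
have := @nu_dense _ X (ball x (2 ^- N))^°; case.
- exists x; exact: nbhsx_ballx (exp2_gt0 _ _).
- exact: open_interior.
move=> y [/interior_subset yx [a _ ay]].
move: yx; rewrite -ay ballEmdist /= metric_sym => ha.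
by exists (pairn a (pairn 0 (2 ^ N).-1)); exists a, N.
Qed.

Lemma small_at_mem x N n : small_at x N n -> alphaX n x.
Proof.
by move=> [a [M [_ -> h]]]; rewrite alphaE radius_small /alpha_center pairnK.
Qed.

Lemma small_at_leq x N N' n : (N <= N')%N -> small_at x N' n -> small_at x N n.
Proof.
by move=> NN' [a [M [N'M -> h]]]; exists a, M; split=> //; apply: leq_trans N'M.
Qed.

(** Formal inclusion loses no point: the offset of the centre and the radius each cost at most
    [2 ^- M], so it suffices that [2 ^- M] is below half of the room that [x] has in the large
    ball. *)
Lemma small_at_formally_in x n' : alphaX n' x ->
  exists N, forall n, small_at x N n -> formally_in n n'.
Proof.
rewrite alphaE => h.
have [|N hN] := @exp2_small R ((alpha_radius n' - mdist (nu X (alpha_center n')) x) / 2).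
  by rewrite divr_gt0 // subr_gt0.
exists N => n [a [M [NM -> ha]]]; rewrite /formally_in radius_small /alpha_center pairnK /=.
have := metric_triangle (nu X a) x (nu X (alpha_center n')).
rewrite [mdist x _]metric_sym /alpha_center; have := @exp2_le R _ _ NM; lra.
Qed.

Lemma small_at_forall_lt x K (P : nat -> nat -> Prop) :
  (forall j, (j < K)%N -> exists N, forall n, small_at x N n -> P j n) ->
  exists N, forall n, small_at x N n -> forall j, (j < K)%N -> P j n.
Proof.
elim: K => [|K IH] h; first by exists 0%N.
have [|N hN] := IH; first by move=> j jK; apply: h; apply: ltnW.
have [M hM] := h K (ltnSn K); exists (maxn N M) => n hn j.
rewrite ltnS leq_eqVlt => /orP[/eqP->|].
  by apply: hM; apply: small_at_leq hn; apply: leq_maxr.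
by apply: hN; apply: small_at_leq hn; apply: leq_maxl.
Qed.

Lemma alpha_open n : open (alphaX n).
Proof.
rewrite openE => x nx; have := nx; rewrite alphaE => nx'.
apply/nbhs_ballP; exists (alpha_radius n - mdist (nu X (alpha_center n)) x) => /=.
  by rewrite subr_gt0.
move=> y; rewrite ballEmdist /= alphaE.
by have := metric_triangle (nu X (alpha_center n)) x y; lra.
Qed.

Lemma alpha_nbhs x (U : set X) : nbhs x U -> exists2 n, alphaX n x & alphaX n `<=` U.
Proof.
move=> /nbhs_ballP[e /= e0 eU]; have [|N hN] := @exp2_small R (e / 2).
  by rewrite divr_gt0.
have [n hn] := small_at_ex x N; exists n; first exact: small_at_mem hn.
case: hn => a [M [NM -> ha]] y; rewrite alphaE radius_small /alpha_center pairnK /= => hy.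
apply: eU; rewrite ballEmdist /=.
have := metric_triangle x (nu X a) y; rewrite [mdist x (nu X a)]metric_sym.
have := @exp2_le R _ _ NM; lra.
Qed.

Lemma named_openP (p : baire) x :
  openX p x <-> exists s, (1 <= p s)%N /\ alphaX (p s - 1) x.
Proof. by split=> [[s /= ps sx]|[s [ps sx]]]; exists s. Qed.

Lemma named_open_open p : open (openX p).
Proof. by apply: bigcup_open => i _; apply: alpha_open. Qed.

Definition Sigma01_of_name (p : baire) : Sigma01 X := MkSigma01 (named_open_open p).

(** The name lists a ball at each stage where its test succeeds, and 0, which lists nothing,
    otherwise. *)
Lemma semidecidable_name (P : baire -> nat -> nat -> Prop) :
  semidecidable (fun p e => P p (unpairn e).1 (unpairn e).2) ->
  exists G : baire -> nat -> baire,
    recursive (fun p e => G p (unpairn e).1 (unpairn e).2) /\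
    forall p i x, openX (G p i) x <-> exists n, P p i n /\ alphaX n x.
Proof.
move=> [T [rT hT]].
exists (fun p i s => if T p (pairn i (unpairn s).1) (unpairn s).2
                     then (unpairn s).1.+1 else 0%N); split.
  recursive_tac.
  by apply: (recursive_comp2 (F := fun p a t => T p a t : nat) rT); recursive_tac.
move=> p i x; rewrite named_openP; split.
  move=> [s []]; case: ifP => // hs _; rewrite subn1 /= => sx.
  exists (unpairn s).1; split=> //.
  by have := (hT p (pairn i (unpairn s).1)).2; rewrite pairnK; apply; exists (unpairn s).2.
move=> [n [Pn nx]].
have [|t ht] := (hT p (pairn i n)).1; first by rewrite pairnK.
by exists (pairn n t); rewrite pairnK /= ht subn1.
Qed.

Lemma cauchy_dist p x i : rep_cauchy X p x -> mdist (nu X (p i)) x <= 2 ^- i.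
Proof.
move=> [/metricType_numDomainType.cvgrPdist_lt pc pd]; apply/ler_addgt0Pr => e e0.
have [N _ hN] := pc e e0.
have := metric_triangle (nu X (p i)) (nu X (p (maxn i N))) x.
have /= := hN (maxn i N) (leq_maxr _ _); rewrite [mdist x _]metric_sym.
have := pd i (maxn i N); rewrite (minn_idPl (leq_maxl i N)); lra.
Qed.

(** The two errors are below half of [2 ^- i] and half of [2 ^- j], so their sum is below the larger
    of these powers. *)
Lemma cauchy_of_dist p x : (forall i, mdist (nu X (p i)) x < 2 ^- i.+1) ->
  rep_cauchy X p x.
Proof.
move=> hp; split.
  apply/metricType_numDomainType.cvgrPdist_lt => e e0.
  have [N hN] := exp2_small e0; exists N => // i /= Ni; rewrite metric_sym.
  apply: lt_trans (hp i) _; apply: le_lt_trans hN; apply: exp2_le.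
  exact: leqW.
move=> i j; have := metric_triangle (nu X (p i)) x (nu X (p j)).
rewrite [mdist x _]metric_sym; have := hp i; have := hp j; rewrite !exp2_half.
have := @exp2_le R _ _ (geq_minl i j); have := @exp2_le R _ _ (geq_minr i j); lra.
Qed.

Lemma cauchy_name_ex x : exists p, rep_cauchy X p x.
Proof.
have /choice[p hp] : forall i, exists a, mdist (nu X a) x < 2 ^- i.+1.
  move=> i; have [n [a [M [iM _ ha]]]] := small_at_ex x i.+1; exists a.
  by apply: lt_le_trans ha _; apply: exp2_le.
by exists p; apply: cauchy_of_dist.
Qed.

(** List the balls whose centre is seen, at some precision [2 ^- i], to be farther from [x] than the
    radius: the distance from the centre to the approximation of [x] exceeds the radius by more than
    [2 ^- i]. *)
Lemma point_complement : exists G : baire -> baire,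
  recursive (fun p e => G p e) /\
  forall p x, rep_cauchy X (evens p) x -> openX (G p) = ~` [set x].
Proof.
have [|G [rG hG]] := @semidecidable_name (fun p (_ : nat) n => exists i,
  (alpha_radius_num n * 2 ^ i + alpha_radius_den n)%:R <
    d (alpha_center n) (p (2 * i)%N) * (alpha_radius_den n * 2 ^ i)%:R :> R).
  apply: semidecidable_ex; apply: semidecidable_dist_gt;
  rewrite /alpha_center /alpha_radius_num /alpha_radius_den; recursive_tac.
exists (fun p => G p 0%N); split.
  by apply: (recursive_comp2 (F := fun p a t => G p a t) rG); recursive_tac.
have test n i z : ((alpha_radius_num n * 2 ^ i + alpha_radius_den n)%:R <
    z * (alpha_radius_den n * 2 ^ i)%:R :> R) = (alpha_radius n + 2 ^- i < z).
  have D := alpha_radius_den_gt0 n.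
  have I : 0 < 2 ^+ i :> R by apply: exprn_gt0.
  rewrite radiusE -[RHS](ltr_pM2r (mulr_gt0 D I)) natrD !natrM natrX.
  congr (_ < _); field.
  by rewrite !lt0r_neq0.
move=> p x px; apply/seteqP; split=> y /=.
  move=> /hG[n [[i]]]; rewrite test alphaE => h ny yx; move: ny; rewrite yx.
  have := cauchy_dist i px; rewrite /evens.
  have := metric_triangle (nu X (alpha_center n)) x (nu X (p (2 * i)%N)).
  by rewrite [mdist x _]metric_sym; lra.
move=> /eqP yx; have xy0 : 0 < mdist x y by rewrite mdist_gt0 eq_sym.
(* Four errors of at most [2 ^- i] must fit into the distance: the ball's radius, its offset from
   [y], the error of the approximation of [x], and the margin in the test. *)
have [|i hi] := @exp2_small R (mdist x y / 4); first by rewrite divr_gt0.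
have [n hn] := small_at_ex y i; apply/hG; exists n; split; last exact: small_at_mem hn.
exists i; rewrite test; case: hn => a [M [iM -> ha]].
rewrite radius_small /alpha_center pairnK /=.
have := cauchy_dist i px; rewrite /evens.
have := metric_triangle x (nu X a) y.
have := metric_triangle x (nu X (p (2 * i)%N)) (nu X a).
rewrite [mdist x (nu X (p _))]metric_sym [mdist (nu X (p _)) (nu X a)]metric_sym.
have := @exp2_le R _ _ iM; lra.
Qed.

End Metric.

(** * The implications *)

Section Implications.
Variables (R : realType) (X : computableMetricSpace R).
Local Notation alphaX := (@alpha R X).
Local Notation openX := (@named_open R X).

Lemma slice_curry (G : nat -> baire) i :
  slice (fun e => G (unpairn e).1 (unpairn e).2) i = G i.
Proof. by apply/funext => j; rewrite /slice pairnK. Qed.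

(** A semidecidable substitute for the inclusion of a ball in a named open set; every sufficiently
    small ball about a point of that set satisfies it. *)
Definition formally_in_name (n : nat) (q : baire) : Prop :=
  exists s, (1 <= q s)%N /\ formally_in X n (q s - 1).

Lemma semidecidable_formally_in_name F (Q : baire -> nat -> baire) :
  recursive F -> recursive (fun p e => Q p (unpairn e).1 (unpairn e).2) ->
  semidecidable (fun p e => formally_in_name (F p e) (Q p e)).
Proof.
move=> rF rQ; apply: semidecidable_ex; apply: semidecidable_and.
  by apply: semidecidable_bool; recursive_tac.
apply: semidecidable_formally_in; last by recursive_tac.
by apply: (recursive_comp rF); recursive_tac.
Qed.

Lemma formally_in_name_subset n q x :
  formally_in_name n q -> alphaX n x -> openX q x.
Proof.
by move=> [s [qs ns]] nx; apply/named_openP; exists s; split=> //;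
   apply: formally_in_subset nx.
Qed.

Lemma small_at_formally_in_name q x : openX q x ->
  exists N, forall n, small_at x N n -> formally_in_name n q.
Proof.
move=> /named_openP[s [qs /small_at_formally_in[N hN]]].
by exists N => n /hN; exists s.
Qed.

Lemma clopen_basis_to_disjoint_refinement :
  (exists (b : nat -> Delta01 X) (S : nat -> nat -> Prop),
    [/\ computable rep_nat (rep_Delta01 X) (op_fun b), ce_rel S &
        refined_inclusion (fun n => b n : set X) S]) ->
  computable (rep_omega (rep_Sigma01 X))
    (rep_prod (rep_omega (rep_Sigma01 X)) rep_baire) (op_Cdot X).
Proof.
move=> [b [S [[c hc] /ce_rel_stages[T [rT hT]] [Sb bS]]]].
(* The constant sequence [m] names the number [m], so [Q m] names [b m]: its even half lists [b m]
   and its odd half the complement. *)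
have /choice[Q hQ] : forall m, exists q, computes c (fun=> m) q /\
    rep_Delta01 X q (b m).
  by move=> m; have [q [cq [y [qy <-]]]] := hc (fun=> m) m erefl I; exists q.
have rQ := @recursive_of_computes c (fun m _ => m) Q
  (recursive_fst recursive_id) (fun m => (hQ m).1).
have bP m x : (b m : set X) x <-> openX (evens (Q m)) x by rewrite (hQ m).2.1.
have bN m x : ~ (b m : set X) x <-> openX (odds (Q m)) x.
  by rewrite (hQ m).2.2 /=; split=> [/contrapT//|?]; apply.
(* An index [k] codes [(i, (s, (m, t)))]. It is valid if entry [s] of the name of [U i] lists a ball
   to which stage [t] confirms that [m] is related. *)
pose idx k := (unpairn (unpairn (unpairn k).2).2).1.
pose valid (p : baire) k :=
  let a := p (pairn (unpairn k).1 (unpairn (unpairn k).2).1) in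
  (1 <= a)%N && T (idx k) (a - 1)%N (unpairn (unpairn (unpairn k).2).2).2.
have rvalid : recursive (fun p k => valid p k : nat).
  rewrite /valid /idx; recursive_tac.
  have r : recursive (fun p k => pairn (idx k) (pairn
      (p (pairn (unpairn k).1 (unpairn (unpairn k).2).1) - 1)
      (unpairn (unpairn (unpairn k).2).2).2)) by rewrite /idx; recursive_tac.
  by apply: recursive_ext (recursive_comp rT r) => p e; rewrite !pairnK.
have rQ1 F : recursive F ->
    recursive (fun p e => evens (Q (idx (F p (unpairn e).1))) (unpairn e).2).
  move=> rF; rewrite /evens; apply: (recursive_comp2 (F := fun _ => Q) rQ); rewrite /idx.
    by have := recursive_comp rF (recursive_fst recursive_id) => r; recursive_tac.
  by recursive_tac.
have rQ2 F : recursive F ->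
    recursive (fun p e => odds (Q (idx (F p (unpairn e).1))) (unpairn e).2).
  move=> rF; rewrite /odds; apply: (recursive_comp2 (F := fun _ => Q) rQ); rewrite /idx.
    by have := recursive_comp rF (recursive_fst recursive_id) => r; recursive_tac.
  by recursive_tac.
(* Piece [k] is its basic set minus the basic sets of the valid [j < k], each removed by means of
   the name of its complement. *)
have [|G [rG hG]] := @semidecidable_name _ X (fun p k n =>
  valid p k /\ formally_in_name n (evens (Q (idx k))) /\
  forall j, (j < k)%N -> ~~ valid p j \/ formally_in_name n (odds (Q (idx j)))).
  apply: semidecidable_and.
    by apply: semidecidable_bool; apply: (recursive_comp rvalid); recursive_tac.
  apply: semidecidable_and.
    apply: semidecidable_formally_in_name; first by recursive_tac.
    by apply: (rQ1 (fun p e => (unpairn e).1)); recursive_tac.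
  apply: (semidecidable_forall_lt (K := fun p e => (unpairn e).1)); last by recursive_tac.
  apply: semidecidable_or.
    apply: semidecidable_bool; apply: recursive_negb.
    by apply: (recursive_comp rvalid); recursive_tac.
  apply: semidecidable_formally_in_name; first by recursive_tac.
  by apply: (rQ2 (fun p e => (unpairn e).2)); recursive_tac.
have GP p k x : openX (G p k) x <-> [/\ valid p k, (b (idx k) : set X) x &
    forall j, (j < k)%N -> valid p j -> ~ (b (idx j) : set X) x].
  rewrite hG; split.
    move=> [n [[vk [nk nj]] nx]]; split=> //.
      by apply/bP; apply: formally_in_name_subset nk nx.
    move=> j /nj[/negP//|jn] _; apply/bN; exact: formally_in_name_subset jn nx.
  move=> [vk /bP/small_at_formally_in_name[N hN] bj].
  (* Only finitely many sets are removed, so one small ball about [x] avoids all of them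
     formally. *)
  have [|M hM] := @small_at_forall_lt _ _ x k (fun j n =>
    ~~ valid p j \/ formally_in_name n (odds (Q (idx j)))).
    move=> j jk; case vj: (valid p j); last by exists 0%N; left.
    have /bN/small_at_formally_in_name[L hL] := bj j jk vj.
    by exists L => n /hL; right.
  have [n hn] := small_at_ex x (maxn N M); exists n; split; last exact: small_at_mem hn.
  split=> //; split.
    by apply: hN; apply: small_at_leq hn; apply: leq_maxl.
  by apply: hM; apply: small_at_leq hn; apply: leq_maxr.
apply: (@computable_recursive _ _ _ _
  (fun p => join (fun e => G p (unpairn e).1 (unpairn e).2) (fun k => (unpairn k).1))).
  rewrite /join; recursive_tac.
  by apply: (recursive_comp2 (F := fun p => G p) rG); recursive_tac.
move=> p U pU covU.
exists (fun k => Sigma01_of_name X (G p k), fun k => (unpairn k).1).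
  split; last by rewrite odds_join.
  by move=> k; rewrite evens_join slice_curry.
split=> /=.
- apply/trivIsetP => i j _ _; wlog ij : i j / (i < j)%N => [H|_].
    rewrite neq_ltn => /orP[ij|ji]; first by apply: H => //; rewrite ltn_eqF.
    by rewrite setIC; apply: H => //; rewrite ltn_eqF.
  apply/seteqP; split=> // x [/= /GP[vi bi _] /GP[_ _ /(_ i ij vi)]]; exact.
- apply/seteqP; split=> // x _.
  have : (\bigcup_i (U i : set X)) x by rewrite covU.
  move=> [i _]; rewrite pU => /named_openP[s [ps /bS[m [mx /hT[t ht]]]]].
  have ex : exists k, valid p k && `[< (b (idx k) : set X) x >].
    exists (pairn i (pairn s (pairn m t))); rewrite /valid /idx !pairnK /=.
    by rewrite [(1 <= _)%N]ps ht /=; apply/asboolP.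
  (* The least valid index whose basic set contains [x] gives the piece containing [x]. *)
  have [k /andP[vk /asboolP bk] kmin] := ex_minnP ex.
  exists k => //=; apply/GP; split=> // j jk vj bj.
  by have := kmin j; rewrite vj leqNgt jk /= => /(_ (asboolT bj)).
- move=> k x /GP[/andP[pk Tk] bk _]; rewrite pU; apply/named_openP.
  exists (unpairn (unpairn k).2).1; split=> //.
  apply: Sb bk; apply/hT; eexists; exact: Tk.
Qed.

(** The new set [i] is the union of the pieces [W k] with [r k = i]; a piece is used for one [i]
    only, so disjointness is kept. *)
Lemma disjoint_refinement_to_reduction :
  computable (rep_omega (rep_Sigma01 X))
    (rep_prod (rep_omega (rep_Sigma01 X)) rep_baire) (op_Cdot X) ->
  computable (rep_omega (rep_Sigma01 X)) (rep_omega (rep_Sigma01 X)) (op_C X).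
Proof.
pose H (q : baire) : baire := fun e =>
  if odds q (unpairn (unpairn e).2).1 == (unpairn e).1 then
    evens q (unpairn e).2 else 0%N.
have HP q i x : openX (slice (H q) i) x <->
    exists k, odds q k = i /\ openX (slice (evens q) k) x.
  rewrite named_openP; split.
    move=> [e []]; rewrite /slice /H !pairnK /=; case: ifP => // /eqP qi qe ex.
    exists (unpairn e).1; split=> //; apply/named_openP; exists (unpairn e).2.
    by rewrite /slice unpairnK.
  move=> [k [qk /named_openP[s [qs sx]]]]; exists (pairn k s).
  by rewrite /slice /H !pairnK /= qk eqxx.
apply: (@computable_reduce _ _ _ _ _ _ _ _ (fun p => p) (fun z => H (odds z))).
- by recursive_tac.
- by rewrite /H /evens /odds; recursive_tac.
move=> p U pU covU; exists U; split=> // q [W r] [/= qW qr] [/= disj cov sub].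
rewrite odds_join; exists (fun i => Sigma01_of_name X (slice (H q) i)).
  by move=> i.
split=> /=.
- apply/trivIsetP => i j _ _ ij; apply/seteqP; split=> // x.
  move=> [/= /HP[k [ki kx]] /HP[l [lj lx]]].
  rewrite -!qW in kx lx; move/trivIsetP: disj => /(_ k l I I).
  move=> disj; have /disj kl : k != l.
    by apply: contra ij => /eqP kl; rewrite -ki -lj kl.
  by suff : set0 x by []; rewrite -kl; split.
- move=> i x /HP[k [ki]]; rewrite -qW => /sub; rewrite -qr ki; exact.
- rewrite covU; apply/seteqP; split=> // x _.
  have : (\bigcup_k (W k : set X)) x by rewrite cov.
  by move=> [k _]; rewrite qW => kx; exists (odds q k) => //; apply/HP; exists k.
Qed.

(** In a disjoint cover the complement of [V i] is the union of the other members, so erasing slice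
    [i] from the whole name leaves a name of it. *)
Lemma computable_op_R :
  computable (rep_omega (rep_Sigma01 X)) (rep_omega (rep_Delta01 X)) (op_R X).
Proof.
pose H (p : baire) : baire := fun e =>
  let i := (unpairn e).1 in let n := (unpairn e).2 in
  if odd n then if (unpairn n./2).1 == i then 0%N else p n./2
  else p (pairn i n./2).
have HP p i : slice (H p) i =
    join (slice p i) (fun n => if (unpairn n).1 == i then 0%N else p n).
  by apply/funext => n; rewrite /slice /H /join !pairnK.
apply: (@computable_recursive _ _ _ _ H); first by rewrite /H; recursive_tac.
move=> p V pV [disj cov].
have clV i : clopen (V i : set X).
  split; first exact: Sigma01P.
  rewrite -openC; have -> : ~` (V i : set X) = \bigcup_(j in [set j | j != i]) V j.
    apply/seteqP; split=> [x nx|x [j /= ji jx] ix].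
      have : (\bigcup_j (V j : set X)) x by rewrite cov.
      by move=> [j _ jx]; exists j => //=; apply/eqP => ji; apply: nx; rewrite -ji.
    move/trivIsetP: disj => /(_ j i I I ji) ji0.
    by suff : set0 x by []; rewrite -ji0; split.
  by apply: bigcup_open => j _; apply: Sigma01P.
exists (fun i => MkDelta01 (clV i)) => // i; rewrite /rep_Delta01 HP evens_join odds_join.
split; first exact: pV.
apply/seteqP; split=> x /=.
  move=> ix /named_openP[s []]; case: ifP => // /negbT si ps px.
  move/trivIsetP: disj => /(_ _ _ I I si) disj; suff : set0 x by [].
  rewrite -disj; split=> //; rewrite pV; apply/named_openP.
  by exists (unpairn s).2; rewrite /slice unpairnK.
move=> nx; have : (\bigcup_j (V j : set X)) x by rewrite cov.
move=> [j _ jx]; have [<-//|/eqP ji] := pselect (j = i).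
case: nx; move: jx; rewrite pV => /named_openP[s [ps sx]].
by apply/named_openP; exists (pairn j s); rewrite pairnK /= (negbTE ji).
Qed.

(** This recursive form makes the prefix codes of the constant names [fun=> i] computable. *)
Lemma code_word_const i k : code_word (mkseq (fun=> i) k) =
  nat_rect (fun=> nat) 0%N (fun _ a => (pairn i a).+1) k.
Proof.
suff H m : code_word (map (fun=> i) (iota m k)) =
    nat_rect (fun=> nat) 0%N (fun _ a => (pairn i a).+1) k by exact: H.
by elim: k m => //= k IH m; rewrite IH.
Qed.

Lemma computable_op_L (Z : computableMetricSpace R) :
  computable (@rep_Cs _ _ (rep_cauchy Z) (rep_Sigma01 X))
    (rep_omega (rep_Sigma01 X)) (op_L X Z).
Proof.
pose w (e k : nat) := pairn (unpairn e).2 (nat_rect (fun=> nat) 0%N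
  (fun _ a => (pairn (unpairn e).1 a).+1) k).
have [c hc] : recursive (fun p e => p (w (unpairn e).1 (unpairn e).2) == 0%N : nat).
  by rewrite /w; recursive_tac.
have [d hd] : recursive (fun p e => (p (w (unpairn e).1 (unpairn e).2)).-1).
  by rewrite /w; recursive_tac.
(* The constant sequence [i] is a Cauchy name of [nu Z i], and [eta p] is evaluated there: [c]
   vanishes exactly where [p] is nonzero, so [Mu c] finds the first decisive prefix and [d] reads
   the value. *)
exists (Comp d (Pair (Pair Fst Snd) (Mu c))) => p u pu _.
have /choice[q hq] : forall i, exists q, eta p (fun=> i) q /\
    (u (nu Z i) : set X) = openX q.
  move=> i; have [|q [eq [y [qy <-]]]] := pu (fun=> i) (nu Z i) _ I; last by exists q.
  split; first exact: cvg_cst.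
  by move=> j k; rewrite mdistxx exp2_gt0.
exists (fun e => q (unpairn e).1 (unpairn e).2); split; last first.
  by eexists; split; [|reflexivity] => i; rewrite slice_curry /= /rep_Sigma01 (hq i).2.
move=> e; have [k [pk lt]] := (hq (unpairn e).1).1 (unpairn e).2.
apply: (@eval_comp _ _ _ _ (pairn e k)); last first.
  by have := hd p (pairn e k); rewrite !pairnK /w -code_word_const pk.
apply: eval_pair (eval_id _ _) _; apply: eval_mu.
  by have := hc p (pairn e k); rewrite !pairnK /w -code_word_const pk.
move=> j /lt pj; exists 0%N.
by have := hc p (pairn e j); rewrite !pairnK /w -code_word_const pj.
Qed.

Lemma reduction_to_indexed :
  computable (rep_omega (rep_Sigma01 X)) (rep_omega (rep_Sigma01 X)) (op_C X) ->
  forall Z : computableMetricSpace R,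
      computable (@rep_Cs _ _ (rep_cauchy Z) (rep_Sigma01 X))
        (rep_omega (rep_Delta01 X))
        (op_comp (op_R X) (op_comp (op_C X) (op_L X Z))).
Proof.
move=> hC Z; apply: computable_comp computable_op_R.
exact: computable_comp (computable_op_L Z) hC.
Qed.

(** The complements of [A] and [B] form a cover of two letters. It shrinks to a partition [V0],
    [V1], and [V1] contains [A], because [V0] avoids [A], and misses [B]. *)
Lemma word_reduction_to_separation :
  computable (rep_star (rep_Sigma01 X)) (rep_star (rep_Sigma01 X))
    (op_Cstar X) ->
  computable (rep_prod (rep_Pi01 X) (rep_Pi01 X)) (rep_Delta01 X) (op_N X).
Proof.
(* The leading 2 is the length of the word; letter 0 is the even half of [p] and letter 1 the odd
   half, as a name of a closed set lists its complement. *)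
pose G (p : baire) : baire := fun e =>
  if e == 0%N then 2 else p (2 * (unpairn e.-1).2 + (unpairn e.-1).1)%N.
(* Even positions read letter 1, which is the answer, and odd positions letter 0, its complement;
   the successor skips the length. *)
pose H (q : baire) : baire := fun e => q (pairn (~~ odd e) e./2).+1.
apply: (@computable_reduce _ _ _ _ _ _ _ _ G (fun z => H (odds z))).
- by rewrite /G; recursive_tac.
- by rewrite /H /odds; recursive_tac.
move=> p [A B] [/= pA pB] AB.
have oA : open (~` (A : set X)) by rewrite openC; apply: Pi01P.
have oB : open (~` (B : set X)) by rewrite openC; apply: Pi01P.
exists [:: MkSigma01 oA; MkSigma01 oB]; split.
- split=> // -[|[|i]] x /=; last (by case: i); move=> [<-]; rewrite /rep_Sigma01 /=.
    rewrite pA setCK; congr openX; apply/funext => s.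
    by rewrite /slice /G /= pairnK addn0.
  rewrite pB setCK; congr openX; apply/funext => s.
  by rewrite /slice /G /= pairnK.
- apply/seteqP; split=> // x _ /=.
  have [Ax|nAx] := pselect ((A : set X) x); last by exists 0%N.
  by exists 1%N => //= Bx; suff : set0 x by []; rewrite -AB.
move=> q [|V0 [|V1 [|? ?]]] [/= q0 qV] [] //= _ sub cov disj.
have cov' x : (V0 : set X) x \/ (V1 : set X) x.
  have : (\bigcup_(j < 2) letter [:: V0; V1] j) x by rewrite cov.
  by move=> [[|[|j]] //= _ jx]; [left|right].
have disj' : (V0 : set X) `&` V1 = set0 by apply: (disj 0%N 1%N).
have V01 : (V1 : set X) = ~` V0.
  apply/seteqP; split=> [x V1x V0x|x V0x]; last by case: (cov' x).
  by suff : set0 x by []; rewrite -disj'.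
have clV : clopen (V1 : set X).
  split; first exact: Sigma01P.
  by rewrite V01 closedC; apply: Sigma01P.
exists (MkDelta01 clV).
  rewrite odds_join; split=> /=.
    rewrite (qV 1%N V1 erefl); congr openX; apply/funext => s.
    by rewrite /slice /evens /H mul2n odd_double doubleK.
  rewrite V01 (qV 0%N V0 erefl); congr (~` openX _); apply/funext => s.
  by rewrite /slice /odds /H mul2n addn1 /= odd_double uphalf_double.
split=> /= x; last by move=> Bx /(sub 1%N erefl).
by move=> Ax; case: (cov' x) => // /(sub 0%N erefl).
Qed.

(** By [point_complement] a Cauchy name of [x] yields a name of the closed set of the single point
    [x]. *)
Lemma separation_to_point_separation :
  computable (rep_prod (rep_Pi01 X) (rep_Pi01 X)) (rep_Delta01 X) (op_N X) ->
  computable (rep_prod (rep_cauchy X) (rep_Pi01 X)) (rep_Delta01 X) (op_Mbar X).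
Proof.
have [G [rG hG]] := point_complement X.
apply: (@computable_reduce _ _ _ _ _ _ _ _ (fun p => join (G p) (odds p))
  (fun z => odds z)).
- rewrite /join /odds.
  have rG' := recursive_comp rG (recursive_half recursive_id).
  by recursive_tac.
- by rewrite /odds; recursive_tac.
move=> p [x A] [/= px pA] nAx; exists (Pi01_point x, A); split.
- split=> /=; last by rewrite odds_join.
  by rewrite /rep_Pi01 evens_join (hG _ _ px) setCK.
- by apply/seteqP; split=> // y [/= -> Ax].
by move=> q W qW NW; exists W => //; rewrite odds_join.
Qed.

(** A name of the open set [U] is literally a name of its closed complement. *)
Lemma point_separation_to_neighbourhood :
  computable (rep_prod (rep_cauchy X) (rep_Pi01 X)) (rep_Delta01 X) (op_Mbar X) ->
  computable (rep_prod (rep_cauchy X) (rep_Sigma01 X)) (rep_Delta01 X) (op_M X).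
Proof.
apply: (@computable_reduce _ _ _ _ _ _ _ _ (fun p => p) (fun z => odds z)).
- by recursive_tac.
- by rewrite /odds; recursive_tac.
move=> p [x U] [/= px pU] Ux.
have clU : closed (~` (U : set X)) by rewrite closedC; apply: Sigma01P.
exists (x, MkPi01 clU); split=> //=.
  by split=> //=; rewrite /rep_Pi01 /= pU.
move=> q W qW [/= xW UW]; exists W; first by rewrite odds_join.
split; first exact: xW.
by move=> y Wy; apply: contrapT => /UW.
Qed.

End Implications.

(** The searched condition ignores the counter, so the search succeeds at 0 or never ends. *)
Lemma ce_rel_bool (b : nat -> nat -> bool) :
  recursive (fun _ e => b (unpairn e).1 (unpairn e).2 : nat) ->
  ce_rel (fun m n => b m n).
Proof.
move=> rb; have [c hc] : recursive (fun _ e =>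
    ~~ b (unpairn (unpairn e).1).1 (unpairn (unpairn e).1).2 : nat).
  apply: recursive_negb; apply: (recursive_comp rb); exact: recursive_fst recursive_id.
exists (Mu c) => m n; split=> [bmn|[k ev]].
  exists 0%N; constructor=> //.
  by have := hc (fun=> 0%N) (pairn (pairn m n) 0); rewrite !pairnK /= bmn.
inversion_clear ev as [| | | | | | | | |? ? ? ck lt].
have := eval_det ck (hc (fun=> 0%N) (pairn (pairn m n) k)); rewrite !pairnK /=.
by case: (b m n).
Qed.

(** * From clopen neighbourhoods to a clopen basis *)

Section ClopenBasis.
Variables (R : realType) (X : computableMetricSpace R).
Local Notation alphaX := (@alpha R X).
Local Notation openX := (@named_open R X).

Definition alpha_Sigma01 n : Sigma01 X := MkSigma01 (alpha_open X n).

Lemma rep_alpha_Sigma01 n : rep_Sigma01 X (fun=> n.+1) (alpha_Sigma01 n).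
Proof.
apply/seteqP; split=> x /=.
  by move=> nx; apply/named_openP; exists 0%N; rewrite subn1.
by move=> /named_openP[_ []]; rewrite subn1.
Qed.

(* The triple [(w, l, n)] codes the finite word [nthn w 0, ..., nthn w l],
   required to be extendable to a Cauchy name by repeating its last letter,
   together with an ideal ball containing the point so named. *)
Definition coherent (e : nat) : Prop :=
  let w := (unpairn e).1 in let l := (unpairn (unpairn e).2).1 in
  let n := (unpairn (unpairn e).2).2 in
  (forall i, (i < l.+1)%N -> forall j, (j < l.+1)%N ->
     mdist (nu X (nthn w i)) (nu X (nthn w j)) * (2 ^ minn i j)%:R + 0%:R < 1%:R) /\
  alphaX n (nu X (nthn w l)).

Definition word_name (w l : nat) : baire := fun i => nthn w (minn i l).

Lemma semidecidable_coherent : semidecidable (fun _ e => coherent e).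
Proof.
apply: semidecidable_and; last first.
  by apply: semidecidable_mem_alpha; recursive_tac.
apply: semidecidable_forall_lt; last by recursive_tac.
apply: semidecidable_forall_lt; last by recursive_tac.
by apply: semidecidable_dist_lt; rewrite /minn; recursive_tac.
Qed.

(** Translates the affine form in [coherent], which suits [semidecidable_dist_lt], back into the
    Cauchy condition. *)
Lemma dist_expn2 (x : R) k : (x * (2 ^ k)%:R + 0%:R < 1%:R) = (x < 2 ^- k).
Proof. by rewrite addr0 natrX -ltr_pdivlMr ?exprn_gt0 // div1r. Qed.

Lemma coherent_cauchy w l n : coherent (pairn w (pairn l n)) ->
  rep_cauchy X (word_name w l) (nu X (nthn w l)).
Proof.
rewrite /coherent !pairnK /= => -[coh _]; split.
  apply/metricType_numDomainType.cvgrPdist_lt => e e0; exists l => // i /= li.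
  by rewrite /word_name (minn_idPr li) mdistxx.
move=> i j; rewrite /word_name.
have := coh (minn i l) _ (minn j l) _; rewrite !ltnS !geq_minr => /(_ erefl erefl).
rewrite dist_expn2; set x := mdist _ _ => h.
have [il|li] := leqP i l; have [jl|lj] := leqP j l.
- by move: h; rewrite (minn_idPl il) (minn_idPl jl).
- by move: h; rewrite (minn_idPl il) (minn_idPr (ltnW lj)) (minn_idPl il)
    (minn_idPl (leq_trans il (ltnW lj))).
- by move: h; rewrite (minn_idPl jl) (minn_idPr (ltnW li)) (minn_idPr jl)
    (minn_idPr (leq_trans jl (ltnW li))).
- rewrite /x (minn_idPr (ltnW li)) (minn_idPr (ltnW lj)) mdistxx; exact: exp2_gt0.
Qed.

(** The Cauchy condition is inherited from [p], and the last letter lies within [2 ^- l] of [x],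
    hence in the ball once [l] is large. *)
Lemma coherent_prefix p x n : rep_cauchy X p x -> alphaX n x ->
  exists L, forall l, (L <= l)%N -> forall w,
    (forall i, (i < l.+1)%N -> nthn w i = p i) -> coherent (pairn w (pairn l n)).
Proof.
move=> px; rewrite alphaE => nx.
have [|L hL] := @exp2_small R (alpha_radius R n - mdist (nu X (alpha_center n)) x).
  by rewrite subr_gt0.
exists L => l Ll w hw; rewrite /coherent !pairnK /=; split.
  by move=> i il j jl; rewrite dist_expn2 !hw //; apply: px.2.
rewrite hw // alphaE.
have := metric_triangle (nu X (alpha_center n)) x (nu X (p l)).
rewrite [mdist x _]metric_sym; have := cauchy_dist l px.
have := @exp2_le R _ _ Ll; lra.
Qed.

(** The zero word with the unit ball about [nu 0]: a default that makes every index select a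
    coherent triple. *)
Lemma coherent_default : coherent (pairn 0 (pairn 0 (pairn 0 0))).
Proof.
rewrite /coherent !pairnK /=; split=> [i _ j _|].
  by rewrite !nthn0 mdistxx mul0r addr0 ltr01.
by rewrite nthn0 alphaE radiusE /alpha_radius_num /alpha_radius_den
  /alpha_center !pairnK mdistxx divr1.
Qed.

Lemma neighbourhood_to_clopen_basis :
  computable (rep_prod (rep_cauchy X) (rep_Sigma01 X)) (rep_Delta01 X) (op_M X) ->
  exists (b : nat -> Delta01 X) (S : nat -> nat -> Prop),
    [/\ computable rep_nat (rep_Delta01 X) (op_fun b), ce_rel S,
        refined_inclusion (fun n => b n : set X) S &
        basis (range (fun n => b n : set X))].
Proof.
move=> [c hc]; have [T [rT hT]] := semidecidable_coherent.
(* Coherence does not depend on the oracle, so its stages are taken at the zero oracle. *)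
pose stage e t := T (fun=> 0%N) e t.
have rstage : recursive (fun _ e => stage (unpairn e).1 (unpairn e).2 : nat).
  have r0 := recursive_relativise (G := fun _ _ _ => 0%N) rT (recursive_const 0).
  apply: (recursive_ext _ (recursive_comp r0
    (recursive_pairn (recursive_const 0) recursive_id))) => p e.
  by rewrite pairnK.
(* An index pairs a candidate triple with a stage; unless the stage confirms coherence, the default
   is taken. The program for [M] is therefore always run on a genuine name. *)
pose sel m := if stage (unpairn m).1 (unpairn m).2 then (unpairn m).1
  else pairn 0 (pairn 0 (pairn 0 0)).
have rsel F : recursive F -> recursive (fun p e => sel (F p e)).
  move=> rF; rewrite /sel; have := recursive_comp rstage rF => r.
  by recursive_tac.
have coh_sel m : coherent (sel m).
  rewrite /sel; case: ifP => [st|_]; last exact: coherent_default.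
  by apply/(hT (fun=> 0%N)); eexists; exact: st.
pose ball_of m := (unpairn (unpairn (sel m)).2).2.
pose G m := join (word_name (unpairn (sel m)).1 (unpairn (unpairn (sel m)).2).1)
  (fun=> (ball_of m).+1).
have rG : recursive (fun _ e => G (unpairn e).1 (unpairn e).2).
  rewrite /G /join /word_name /minn /ball_of.
  have := rsel _ (recursive_fst recursive_id) => r; recursive_tac.
have /choice[Q /choice[b hb]] : forall m, exists q, exists W : Delta01 X,
    [/\ computes c (G m) q, rep_Delta01 X q W & (W : set X) `<=` alphaX (ball_of m)].
  move=> m; move: (coh_sel m) (erefl (G m)); rewrite {2}/G /ball_of.
  rewrite -(unpairnK (sel m)) -(unpairnK (unpairn (sel m)).2) !pairnK /=.
  move: (unpairn (sel m)).1 (unpairn (unpairn (sel m)).2).1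
    (unpairn (unpairn (sel m)).2).2 => w l n coh ->.
  have [||q [cq [W [qW [_ Wn]]]]] := hc (join (word_name w l) (fun=> n.+1))
    (nu X (nthn w l), alpha_Sigma01 n).
  - rewrite /rep_prod evens_join odds_join; split; first exact: coherent_cauchy coh.
    exact: rep_alpha_Sigma01.
  - by move: coh; rewrite /coherent !pairnK => -[].
  by exists q, W.
have rQ := recursive_of_computes rG (fun m => let: And3 h _ _ := hb m in h).
have bP m x : (b m : set X) x <-> openX (evens (Q m)) x.
  by have [_ [-> _] _] := hb m.
have refined : refined_inclusion (fun n => b n : set X) (fun m n => ball_of m == n).
  split=> [m n /eqP <-|n x nx]; first by have [] := hb m.
  have [p px] := cauchy_name_ex x.
  have [||r [cr [W [[rW _] [/= xW _]]]]] := hc (join p (fun=> n.+1)) (x, alpha_Sigma01 n).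
  - by rewrite /rep_prod evens_join odds_join; split=> //; apply: rep_alpha_Sigma01.
  - exact: nx.
  move: xW; rewrite rW => /named_openP[s [rs sx]].
  (* This entry of the even half of the answer lists a ball containing [x]; preserving this one
     value is enough. *)
  have [K hK] := eval_finite_use (cr (2 * s)%N).
  have [L hL] := coherent_prefix px nx.
  (* The prefix must reach [K] for the finite use and [L] for coherence. *)
  have [w hw] := nthn_surj p (maxn K L).+1.
  have coh := hL _ (leq_maxr K L) w hw.
  have [t ht] := (hT (fun=> 0%N) _).1 coh.
  pose m := pairn (pairn w (pairn (maxn K L) n)) t.
  have selm : sel m = pairn w (pairn (maxn K L) n).
    by rewrite /sel /m !pairnK /= /stage ht.
  exists m; split; last by rewrite /ball_of selm !pairnK.
  apply/bP/named_openP; exists s; rewrite /evens.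
  suff -> : Q m (2 * s)%N = r (2 * s)%N by split.
  (* Below [K] the oracle [G m] agrees with the original one: the odd halves are the same constant,
     and an even position [i] reads letter [i./2] of [p], inside the prefix. *)
  have [cQ _ _] := hb m; apply: eval_det (cQ _) _; apply: hK => i iK.
  rewrite /G /ball_of selm !pairnK /= /join; case: ifP => // _.
  have ih : (i./2 <= i)%N by rewrite -{2}(odd_double_half i) -addnn addnA leq_addl.
  rewrite /word_name (minn_idPl _) ?hw // ?ltnS; last first.
    by apply: leq_trans (leq_maxl _ _); apply: leq_trans ih (ltnW iK).
  by apply: leq_trans (leq_maxl _ _); apply: leq_trans ih (ltnW iK).
exists b, (fun m n => ball_of m == n); split=> //.
- apply: (@computable_recursive _ _ _ _ (fun p => Q (p 0%N))).
    by apply: (recursive_comp2 (F := fun _ => Q) rQ); recursive_tac.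
  by move=> p n <- _; exists (b (p 0%N)) => //; have [] := hb (p 0%N).
- apply: ce_rel_bool; rewrite /ball_of.
  have := rsel _ (recursive_fst recursive_id) => r; recursive_tac.
split=> [_ [n _ <-]|x U]; first by have [] := Delta01P (b n).
move=> /alpha_nbhs[n nx nU]; have [m [mx /refined.1 mn]] := refined.2 n x nx.
exists (b m : set X); first by split=> //; exists m.
by apply: subset_trans nU.
Qed.

End ClopenBasis.

(** * The discrete space of natural numbers *)

Definition discrete_nat (R : realType) : Type := nat.

Section DiscreteNat.
Variable R : realType.

Definition discrete_dist (i j : discrete_nat R) : R := ((i : nat) != j)%:R.

Lemma discrete_distxx i : discrete_dist i i = 0.
Proof. by rewrite /discrete_dist eqxx. Qed.

Lemma discrete_dist_positivity i j : discrete_dist i j = 0 -> i = j.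
Proof.
rewrite /discrete_dist; case: eqP => //= _ /eqP.
by rewrite oner_eq0.
Qed.

Lemma discrete_dist_sym i j : discrete_dist i j = discrete_dist j i.
Proof. by rewrite /discrete_dist eq_sym. Qed.

Lemma discrete_dist_triangle j i k :
  discrete_dist i k <= discrete_dist i j + discrete_dist j k.
Proof.
rewrite /discrete_dist -natrD ler_nat.
have [->|_] := eqVneq (i : nat) j; first by [].
exact: leq_trans (leq_b1 _) (leq_addr _ _).
Qed.

(** The metric is put on an alias, whose parameter fixes the field of the distances, and not on
    [nat] itself. *)
HB.instance Definition _ := Choice.copy (discrete_nat R) nat.
HB.instance Definition _ := @isMetric.Build R (discrete_nat R) discrete_dist
  discrete_distxx discrete_dist_positivity discrete_dist_sym
  discrete_dist_triangle.

Lemma discrete_nu_dense : dense (range (fun i : nat => i : discrete_nat R)).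
Proof. by move=> O [i Oi] _; exists i; split=> //; exists i. Qed.

Lemma discrete_nu_computable :
  computable_double_seq (fun i j : nat => mdist (i : discrete_nat R) j).
Proof.
have [c hc] : recursive (fun _ e =>
    pairn (pairn ((unpairn e).1 != (unpairn (unpairn e).2).1) 0) 0) by recursive_tac.
exists c => i j k; exists (pairn (pairn (i != j) 0) 0); split.
  by have := hc (fun=> 0%N) (pairn i (pairn j k)); rewrite !pairnK.
by rewrite /nuQ !pairnK subr0 divr1 subrr normr0 exp2_gt0.
Qed.

Definition discrete_space : computableMetricSpace R :=
  ComputableMetricSpace discrete_nu_dense discrete_nu_computable.

Lemma discrete_dist_lt1 (i j : discrete_space) : mdist i j < 1 -> i = j.
Proof.
rewrite [mdist i j]/(discrete_dist i j) /discrete_dist.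
by case: eqP => //= _; rewrite ltxx.
Qed.

(** Entry 0 alone is only known to be at distance at most 1 from the limit. Entry 1 mediates: it is
    within 1/2 of the limit and at distance less than 1 from entry 0. *)
Lemma rep_cauchy_discrete p (i : discrete_space) : rep_cauchy discrete_space p i ->
  p 0%N = i.
Proof.
move=> pi; have -> : i = p 1%N.
  apply/esym/discrete_dist_lt1; apply: le_lt_trans (cauchy_dist 1 pi) _.
  by rewrite invf_lt1 ?ltr1n.
by apply: (@discrete_dist_lt1 (p 0%N) (p 1%N)); have := pi.2 0%N 1%N; rewrite invr1.
Qed.

End DiscreteNat.

Section WordReduction.
Variables (R : realType) (X : computableMetricSpace R).
Local Notation openX := (@named_open R X).
Local Notation Z := (discrete_space R).

(** The realiser depends on entry 0 of the name only, so it is locally constant. *)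
Lemma sequence_continuous_realiser (P : nat -> baire) :
  has_continuous_realiser (rep_cauchy Z) (rep_Sigma01 X)
    (fun i : Z => Sigma01_of_name X (P i)).
Proof.
exists setT, (fun q => P (q 0%N)); split; last first.
  move=> q i qi _; exists (P (q 0%N)); split=> //.
  by eexists; split; [|reflexivity]; rewrite /rep_Sigma01 (rep_cauchy_discrete qi).
apply: continuous_subspaceT => q; apply/pointwise_cvgP => t.
have q0 : \forall q' \near q, q' 0%N = q 0%N.
  have /(_ [set q 0%N]) := (@pointwise_cvgP _ _ (nbhs q) q (nbhs_filter q)).1 cvg_id 0%N.
  by apply; apply: discrete_set1.
by move=> A nA; apply: filterS q0 => q' /= ->; apply: nbhs_singleton.
Qed.

Definition Cs_of_sequence (P : nat -> baire) : Cs (rep_cauchy Z) (rep_Sigma01 X) :=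
  MkCs (sequence_continuous_realiser P).

(** A Kleene associate of the map sending [q] to [P (q 0)]: undecided on the empty prefix, it
    answers from the first letter on every longer one. *)
Definition eta_of_sequence (P : nat -> baire) : baire := fun e =>
  if (unpairn e).2 == 0%N then 0%N
  else (P (unpairn (unpairn e).2.-1).1 (unpairn e).1).+1.

Lemma rep_Cs_of_sequence P : rep_Cs (eta_of_sequence P) (Cs_of_sequence P).
Proof.
move=> q i qi _; exists (P (q 0%N)); split; last first.
  by eexists; split; [|reflexivity]; rewrite /rep_Sigma01 (rep_cauchy_discrete qi).
move=> n; exists 1%N; rewrite /eta_of_sequence; split.
  by rewrite /= !pairnK.
by move=> [|]//; rewrite pairnK.
Qed.

(** The word is padded with empty sets to a sequence, that is, a map on the discrete space. The
    reduced sets beyond the length of the word are then empty, so the initial ones still cover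
    [X]. *)
Lemma indexed_to_word_reduction :
  computable (@rep_Cs _ _ (rep_cauchy Z) (rep_Sigma01 X))
    (rep_omega (rep_Delta01 X))
    (op_comp (op_R X) (op_comp (op_C X) (op_L X Z))) ->
  computable (rep_star (rep_Sigma01 X)) (rep_star (rep_Sigma01 X)) (op_Cstar X).
Proof.
pose pad (p : baire) (i : nat) : baire := fun n =>
  if (i < p 0)%N then p (pairn i n).+1 else 0%N.
(* The length is copied from the original name, and the factor 2 selects the even half of each
   clopen name, which lists the set itself. *)
apply: (@computable_reduce _ _ _ _ _ _ _ _ (fun p => eta_of_sequence (pad p))
  (fun z e => if e == 0%N then evens z 0%N
              else odds z (pairn (unpairn e.-1).1 (2 * (unpairn e.-1).2)))).
- by rewrite /eta_of_sequence /pad; recursive_tac.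
- by rewrite /evens /odds; recursive_tac.
move=> p U [sU pU] covU; exists (Cs_of_sequence (pad p)).
have padE i x : openX (pad p i) x <-> (i < size U)%N /\ letter U i x.
  rewrite sU /letter named_openP /pad; case ip: (i < p 0)%N; last first.
    by split=> [[s []]|[]].
  have Ui : (i < size U)%N by rewrite sU.
  case EU : (onth U i) => [V|]; last first.
    by move: Ui; rewrite -onthTE EU.
  have -> : nth set0 (map (@Sigma01_set X) U) i = V.
    by apply: onth_nth; rewrite onth_map EU.
  rewrite (pU i V EU) named_openP.
  by split=> [[s sx]|[_ [s sx]]]; [split=> //|]; exists s.
have cov_pad : covers (fun i => Sigma01_of_name X (pad p i)).
  apply/seteqP; split=> // x _.
  have : (\bigcup_(i < size U) letter U i) x by rewrite covU.
  by move=> [i iU ix]; exists i => //; apply/padE.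
split.
- exact: rep_Cs_of_sequence.
- split.
    by split=> // _ ->.
  by move=> W [_ -> [disj _ cov]]; split=> //; rewrite /covers cov.
move=> q D qD [W [_ -> [disj sub cov]] DW].
have oD i : open (D i : set X) by case: (Delta01P (D i)).
pose V := mkseq (fun i => MkSigma01 (oD i)) (size U).
have letV i : (i < size U)%N -> letter V i = W i.
  by move=> iU; rewrite /letter (nth_map (W i)) ?size_mkseq // nth_mkseq //= DW.
exists V.
  split; first by rewrite /= size_mkseq evens_join.
  move=> i Y Yi; have iU : (i < size U)%N.
    by rewrite -(size_mkseq (fun i => MkSigma01 (oD i)) (size U)) -onthTE Yi.
  have -> : Y = MkSigma01 (oD i) by rewrite -(onth_nth Y _ _ _ Yi) nth_mkseq.
  rewrite /rep_Sigma01 /= (qD i).1; congr openX; apply/funext => s.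
  by rewrite /slice pairnK odds_join.
split.
- exact: size_mkseq.
- by move=> i iU x; rewrite letV // => /sub /padE[].
- apply/seteqP; split=> // x _.
  have : (\bigcup_i (W i : set X)) x by rewrite cov cov_pad.
  move=> [i _ ix]; have /padE[iU _] := sub i x ix.
  by exists i => //; rewrite letV.
- move=> i j iU jU ij; rewrite !letV //.
  by move/trivIsetP: disj; apply=> //; apply/eqP.
Qed.

End WordReduction.

Theorem proposition5p1 (R : realType) (X : computableMetricSpace R) :
  [<->
    exists (b : nat -> Delta01 X) (S : nat -> nat -> Prop),
      [/\ computable rep_nat (rep_Delta01 X) (op_fun b),
          ce_rel S,
          refined_inclusion (fun n => b n : set X) S &
          basis (range (fun n => b n : set X))];
    computable (rep_prod (rep_Pi01 X) (rep_Pi01 X)) (rep_Delta01 X) (op_N X);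
    computable (rep_prod (rep_cauchy X) (rep_Pi01 X)) (rep_Delta01 X)
      (op_Mbar X);
    computable (rep_prod (rep_cauchy X) (rep_Sigma01 X)) (rep_Delta01 X)
      (op_M X);
    computable (rep_omega (rep_Sigma01 X))
      (rep_prod (rep_omega (rep_Sigma01 X)) rep_baire) (op_Cdot X);
    computable (rep_omega (rep_Sigma01 X)) (rep_omega (rep_Sigma01 X)) (op_C X);
    forall Z : computableMetricSpace R,
      computable (@rep_Cs _ _ (rep_cauchy Z) (rep_Sigma01 X))
        (rep_omega (rep_Delta01 X))
        (op_comp (op_R X) (op_comp (op_C X) (op_L X Z)));
    computable (rep_star (rep_Sigma01 X)) (rep_star (rep_Sigma01 X))
      (op_Cstar X) ].
Proof.
have basis_to_refinement := @clopen_basis_to_disjoint_refinement R X.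
(* The passage from (1) to (2) runs through (5), (6), (7) and (8); this composes the steps from (5)
   to (8). *)
have to_word cdot := indexed_to_word_reduction (reduction_to_indexed
  (@disjoint_refinement_to_reduction R X cdot) (discrete_space R)).
tfae.
- move=> [b [S [hb hS hbS _]]]; apply: word_reduction_to_separation.
  by apply: to_word; apply: basis_to_refinement; exists b, S.
- exact: separation_to_point_separation.
- exact: point_separation_to_neighbourhood.
- move=> /neighbourhood_to_clopen_basis[b [S [hb hS hbS _]]].
  by apply: basis_to_refinement; exists b, S.
- exact: disjoint_refinement_to_reduction.
- exact: reduction_to_indexed.
- by move=> /(_ (discrete_space R)); apply: indexed_to_word_reduction.
- move=> /word_reduction_to_separation/separation_to_point_separation.
  move=> /point_separation_to_neighbourhood; exact: neighbourhood_to_clopen_basis.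
Qed.
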